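(* Let $\mathcal{G}$ be an infinite simple graph with bounded degree. For any $h\neq 0$, $\beta \geq 0$, $k \in \mathbb{N}_{>0}$, $N\in \mathbb{N}_{\geq 2}$, there are positive constants $c_8 = c_8( \mathcal{G}, N, \beta, h, k)$, $C_8 = C_8( \mathcal{G}, N, \beta, h, k)$ such that the following holds. Let $(\mathcal{G}_L)_{L \in \mathbb{N}}$, with $\mathcal{G}_L = ( \mathcal{V}_L, \mathcal{E}_L)\subset \mathcal{G}$, be an arbitrary sequence of finite graphs. Then, for any $L \in \mathbb{N}$ and any $x, y \in \mathcal{V}_L$, $$0 \leq \langle S^1_x S^1_y\rangle^{(k)}_{\mathcal{G}_L,N,\beta,h} \leq C_8 \, e^{-c_8 \, d_{\mathcal{G}}(x,y)},$$ where $d_{\mathcal{G}}(x,y)$ denotes the graph distance between $x$ and $y$ in $\mathcal{G}$. Moreover, the choice of $c_8$ can be made so that $c_8 = O(h^2)$ in the limit as $h \rightarrow 0$.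
   Context: $k$-truncated Spin $O(N)$ model. For a finite simple graph $\mathcal{H}=(\mathcal{V},\mathcal{E})$ and $N\in\mathbb{N}_{>0}$ let $\Omega_{\mathcal{H},N}=(\mathbb{S}^{N-1})^{\mathcal{V}}$, where $\mathbb{S}^{N-1}\subset\mathbb{R}^N$ is the unit sphere. For $f:\Omega_{\mathcal{H},N}\to\mathbb{R}$ define $$\langle f\rangle^{(k)}_{\mathcal{H},N,\beta,h} =\frac{1}{Z^{(k)}_{\mathcal{H},N,\beta,h}}\int_{\Omega_{\mathcal{H},N}}\mathrm{d}\varphi \, \Big ( \prod_{ \{x, y\} \in \mathcal{E} } \sum_{\ell=0}^k \beta^\ell \, \frac{ (\varphi_{x} \cdot \varphi_y)^\ell}{\ell!} \Big ) \exp\Big( h \sum_{x \in \mathcal{V} } \varphi^N_x \Big)\, f(\varphi),$$ where $\cdot$ is the usual inner product of $\mathbb{R}^N$, $\varphi_x^i$ is the $i$-th component of $\varphi_x$, $\mathrm{d}\varphi=\prod_{x\in\mathcal{V}}\mathrm{d}\varphi_x$ with $\mathrm{d}\varphi_x$ the uniform measure on $\mathbb{S}^{N-1}$, and $Z^{(k)}_{\mathcal{H},N,\beta,h}$ is the constant such that $\langle 1\rangle^{(k)}_{\mathcal{H},N,\beta,h}=1$. (The underlying measure may be signed.) For $x\in\mathcal{V}$, $S_x(\varphi):=\varphi_x$ is the spin at $x$, with components $S_x=(S_x^1,\dots,S_x^N)$. The notation $\mathcal{G}_L\subset\mathcal{G}$ means that $\mathcal{G}_L$ is a subgraph of $\mathcal{G}$.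 *)

(* Defs.v *)
From HB Require Import structures.
From mathcomp Require Import all_boot all_order all_algebra finmap.
From mathcomp Require Import all_classical all_reals all_analysis.
From mathcomp Require Import measurable_realfun.

Set Implicit Arguments.
Unset Strict Implicit.
Unset Printing Implicit Defensive.

Import Order.TTheory GRing.Theory Num.Theory.
Import numFieldNormedType.Exports.

Local Open Scope classical_set_scope.
Local Open Scope ring_scope.

Record sgraph := SGraph {
  vertex :> choiceType;
  adj : rel vertex;
  adj_sym : symmetric adj;
  adj_irr : irreflexive adj }.

Definition bounded_degree (G : sgraph) : Prop :=
  exists D : nat, forall x : G, ([set y : G | adj x y] #<= `I_D)%card.

(* The value is +oo when [x] and [y] are in different components; the bound
   C * exp(- c * d(x, y)) is then 0, by the conventions of [expeR]. *)
Definition graph_dist (R : realType) (G : sgraph) (x y : G) : \bar R :=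
  ereal_inf [set (n%:R)%:E | n in
    [set n : nat | exists p : seq G,
       [/\ path (@adj G) x p, last x p = y & size p = n]]].

(* Subgraphs need not be induced: [sub_adj] may omit edges of [G]. *)
Record fin_subgraph (G : sgraph) := FinSubgraph {
  sub_vertex : {fset G};
  sub_adj : rel sub_vertex;
  sub_adj_sym : symmetric sub_adj;
  sub_adjP : forall x y, sub_adj x y -> adj (val x) (val y) }.

Section product_prob.
Context d (T : measurableType d) (R : realType).

Definition tcons n (p : T * n.-tuple T) : n.+1.-tuple T :=
  [tuple of p.1 :: p.2].

Lemma measurable_tcons n : measurable_fun [set: T * n.-tuple T] (@tcons n).
Proof. exact: measurable_cons. Qed.

HB.instance Definition _ n :=
  isMeasurableFun.Build _ _ _ _ (@tcons n) (@measurable_tcons n).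

Fixpoint product_prob (P : probability T R) n : probability (n.-tuple T) R :=
  match n with
  | 0 => \d_([tuple] : 0.-tuple T)
  | n'.+1 => distribution (P \x product_prob P n')%E (@tcons n')
  end.

End product_prob.

Section uniform_sphere.
Context (R : realType) (N : nat).

Definition dot (u v : N.-tuple R) : R := \sum_(i < N) tnth u i * tnth v i.

(* [normal_prob] lives on [measurableTypeR R], which has the same Borel
   sets as the default instance on [R] but is a different structure. *)
Definition direction (v : N.-tuple (measurableTypeR R)) : N.-tuple R :=
  [tuple tnth v i / Num.sqrt (dot v v) | i < N].

Lemma measurable_direction :
  measurable_fun [set: N.-tuple (measurableTypeR R)] direction.
Proof.
apply/measurable_fun_tnthP => i.
rewrite (_ : _ \o _ =
    fun v => tnth v i * (Num.sqrt (dot v v) `^ (-1))); last first.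
  by apply/funext => v /=; rewrite tnth_mktuple powR_inv1// sqrtr_ge0.
apply: measurable_funM; first exact: measurable_tnth.
apply: (measurableT_comp (measurable_powR _)).
apply: measurableT_comp.
  by apply: continuous_measurable_fun; exact: sqrt_continuous.
by apply: measurable_sum => j; apply: measurable_funM; exact: measurable_tnth.
Qed.

HB.instance Definition _ :=
  isMeasurableFun.Build _ _ _ _ direction measurable_direction.

(* The standard Gaussian measure on R^N is invariant under rotations, hence so
   is the law of the direction of a standard Gaussian vector: it is the uniform
   probability measure on the unit sphere. The junk value [direction 0 = 0] is
   irrelevant when [0 < N], as the origin is then negligible. *)
Definition uniform_sphere : probability (N.-tuple R) R :=
  distribution (product_prob (normal_prob 0 1) N) direction.

End uniform_sphere.

Section truncated_spin_ON.
Context (R : realType) (V : finType) (e : rel V) (N k : nat) (beta h : R).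

(* The spin at the vertex [x] is the entry of index [enum_rank x]. *)
Definition config := #|V|.-tuple (N.-tuple R).

Definition spin (x : V) (phi : config) : N.-tuple R := tnth phi (enum_rank x).

(* Components are numbered from 0: S_x^i is [spin_comp x i.-1]. *)
Definition spin_comp (x : V) (i : nat) (phi : config) : R := (spin x phi)`_i.

(* [enum_rank p.1 < enum_rank p.2] selects one orientation of each edge. *)
Definition weight (phi : config) : R :=
  (\prod_(p : V * V | e p.1 p.2 && (enum_rank p.1 < enum_rank p.2)%N)
     \sum_(l < k.+1)
       beta ^+ l * (dot (spin p.1 phi) (spin p.2 phi) ^+ l / l`!%:R))
  * expR (h * \sum_(x : V) spin_comp x N.-1 phi).

(* This product measure is carried by the configurations of unit vectors, so
   that integrating over all of [config] amounts to integrating over them. *)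
Definition config_prob : probability config R :=
  product_prob (uniform_sphere R N) #|V|.

Definition partition_function : R :=
  \int[config_prob]_(phi in setT) weight phi.

Definition expectation_ON (f : config -> R) : R :=
  partition_function^-1 * \int[config_prob]_(phi in setT) (weight phi * f phi).

End truncated_spin_ON.

(* Main.v *)
Require Import Defs.
From mathcomp Require Import all_boot all_order all_algebra finmap.
From mathcomp Require Import all_classical all_reals all_analysis.
From mathcomp Require Import measurable_realfun ring lra zify.

Set Implicit Arguments.
Unset Strict Implicit.
Unset Printing Implicit Defensive.

Import Order.TTheory GRing.Theory Num.Theory.
Import numFieldNormedType.Exports.

Local Open Scope classical_set_scope.
Local Open Scope ring_scope.

(** Write [m] for the single-spin moments of [exp (h S^N)] times a monomial:
    after a reflection one may take [h > 0], and then every [m] is nonnegative.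
    Expanding the truncated edge factors turns every quantity into a sum of
    products of moments with nonnegative coefficients, whence the lower bound.

    For the upper bound let [A v] be the unnormalised correlation of [S^1_x]
    and [S^1_v], and rotate the spin at [v] in the plane (1, N) at speed [a v].
    The Ward identity expresses [h * sum_v a v * A v] as [a x] times the mean of
    [S^N_x], minus a sum over the edges [uv] of [(a u - a v)] times a current.
    Since at most [k] factors per edge occur, only finitely many exponents are
    possible at a vertex, so that inserting an extra factor [S^N_v] costs at most
    a constant; hence the current is at most a constant times [A u + A v].
    With [a v = q ^ d(x, v)] and [q - 1] small, as in the Combes-Thomas method,
    the edge sum is at most half of the left-hand side, and [sum_v a v * A v] is
    bounded uniformly in the volume. The rate may be replaced by any smaller
    one, so the bound [O(h ^ 2)] costs nothing. *)

(** * Integration against product probabilities *)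

(** The truncated edge factors can be negative, so no inequality may be read off pointwise, not even
    [S^N_v <= 1] under the integral. Every comparison is therefore made after integration and
    monomial by monomial, on polynomials with nonnegative coefficients in the spins ([cone]).
    Differentiating a truncated exponential lowers its degree by one, so the edge factor in the
    current lacks the top term of the original one; integrated against the rest of the integrand,
    that term is nonnegative and can be added back.

    Rotation invariance is needed only infinitesimally. Since the sphere measure is the law of the
    direction of a Gaussian vector with independent coordinates, integrating by parts in one
    coordinate at a time suffices, without a change of variables in R^N.

    The graph distance may be infinite, whereas the speeds [a v] are real numbers. They are built
    from the distance truncated at an arbitrary [n], with bounds independent of [n]; this also
    forces the correlation between two components of the graph to vanish. *)

Section product_integral.
Context d1 d2 (T1 : measurableType d1) (T2 : measurableType d2) (R : realType).
Variables (P : probability T1 R) (Q : probability T2 R).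
Variables (f : T1 -> R) (g : T2 -> R).
Hypotheses (intf : P.-integrable setT (EFin \o f))
  (intg : Q.-integrable setT (EFin \o g)).

Let measurable_mul :
  measurable_fun setT (fun z : T1 * T2 => (f z.1 * g z.2)%:E).
Proof.
apply/measurable_EFinP; apply: measurable_funM.
  by apply: measurableT_comp => //; apply/measurable_EFinP; case/integrableP: intf.
by apply: measurableT_comp => //; apply/measurable_EFinP; case/integrableP: intg.
Qed.

Lemma integrable_prod_mul :
  (P \x Q)%E.-integrable setT (fun z => (f z.1 * g z.2)%:E).
Proof.
apply/integrable12ltyP => //=.
have /integrableP[mf fi] := intf; have /integrableP[mg gi] := intg.
under eq_integral.
  move=> x _.
  under eq_integral do rewrite normrM EFinM.
  rewrite ge0_integralZl//=.
  - over.
  - by apply/measurable_EFinP; apply: measurableT_comp => //; apply/measurable_EFinP.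
rewrite /= ge0_integralZr//=; last 2 first.
- by apply/measurable_EFinP; apply: measurableT_comp => //; apply/measurable_EFinP.
- exact: integral_ge0.
by rewrite lte_mul_pinfty// ?integral_ge0// ge0_fin_numE ?integral_ge0.
Qed.

Lemma Rintegral_prod_mul :
  \int[(P \x Q)%E]_z (f z.1 * g z.2) = (\int[P]_x f x) * (\int[Q]_y g y).
Proof.
rewrite /Rintegral -(integral12_prod_meas1 integrable_prod_mul)/= /fubini_F/=.
under eq_integral.
  move=> x _.
  under eq_integral do rewrite EFinM.
  rewrite integralZl//.
  over.
rewrite /= -fineM ?(integrable_fin_num measurableT)//.
have /fineK <- : (\int[Q]_y (g y)%:E)%E \is a fin_num.
  exact: (integrable_fin_num measurableT).
by rewrite integralZr.
Qed.

End product_integral.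

Section product_prob_integral.
Context d (T : measurableType d) (R : realType) (P : probability T R).

Lemma ge0_integral_product_probS n (f : n.+1.-tuple T -> \bar R) :
  measurable_fun setT f -> (forall v, 0 <= f v)%E ->
  (\int[product_prob P n.+1]_v f v =
   \int[P]_t \int[product_prob P n]_w f (tcons (t, w)))%E.
Proof.
move=> mf f0; rewrite [LHS]ge0_integral_distribution// fubini_tonelli1//.
- by apply: (measurableT_comp mf); exact: measurable_tcons.
- by move=> z; exact: f0.
Qed.

Lemma prod_tcons n (f : 'I_n.+1 -> T -> R) t (w : n.-tuple T) :
  \prod_i f i (tnth (tcons (t, w)) i) =
  f ord0 t * \prod_i f (lift ord0 i) (tnth w i).
Proof.
by rewrite big_ord_recl tnth0; congr (_ * _); apply: eq_bigr => i _; rewrite tnthS.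
Qed.

Lemma measurable_prod_tnth n (f : 'I_n -> T -> R) :
  (forall i, measurable_fun setT (f i)) ->
  measurable_fun setT (fun v : n.-tuple T => \prod_i f i (tnth v i)).
Proof.
move=> mf; apply: measurable_prod => i _.
by apply: measurableT_comp; [exact: mf|exact: measurable_tnth].
Qed.

Arguments product_prob : simpl never.

Lemma integrable_product_prob n (f : 'I_n -> T -> R) :
  (forall i, P.-integrable setT (EFin \o f i)) ->
  (product_prob P n).-integrable setT
    (fun v => (\prod_i f i (tnth v i))%:E).
Proof.
elim: n f => [|n IH] f intf.
  under eq_fun do rewrite big_ord0.
  exact: finite_measure_integrable_cst.
have mf i : measurable_fun setT (f i).
  by apply/measurable_EFinP; case/integrableP: (intf i).
apply: (integrable_pushforward (measurable_tcons (n:=n))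
  (mu := (P \x product_prob P n)%E)) => //.
- apply/measurable_EFinP; apply: measurable_prod_tnth; exact: mf.
- rewrite preimage_setT.
  rewrite (_ : _ \o _ = fun z =>
      (f ord0 z.1 * \prod_(i < n) f (lift ord0 i) (tnth z.2 i))%:E); last first.
    by apply/funext => -[t w] /=; rewrite prod_tcons.
  have intg := IH _ (fun i => intf (lift ord0 i)).
  exact: (integrable_prod_mul (intf ord0) intg).
Qed.

Lemma Rintegral_product_prob n (f : 'I_n -> T -> R) :
  (forall i, P.-integrable setT (EFin \o f i)) ->
  \int[product_prob P n]_v (\prod_i f i (tnth v i)) =
  \prod_i \int[P]_x f i x.
Proof.
elim: n f => [|n IH] f intf.
  rewrite big_ord0.
  under eq_Rintegral do rewrite big_ord0.
  by rewrite /= Rintegral_cst// mul1r [X in fine X]probability_setT.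
have mf i : measurable_fun setT (f i).
  by apply/measurable_EFinP; case/integrableP: (intf i).
have intg := integrable_product_prob (fun i => intf (lift ord0 i)).
rewrite big_ord_recl -IH// -(Rintegral_prod_mul (intf ord0) intg).
have E : (EFin \o (fun v => \prod_i f i (tnth v i))) \o tcons (n:=n) =
    (fun z => (f ord0 z.1 * \prod_(i < n) f (lift ord0 i) (tnth z.2 i))%:E).
  by apply/funext => -[t w] /=; rewrite prod_tcons.
rewrite /Rintegral (integral_pushforward (measurable_tcons (n:=n))
  (mu := (P \x product_prob P n)%E))//.
- by congr fine; rewrite preimage_setT E.
- apply/measurable_EFinP; apply: measurable_prod_tnth; exact: mf.
- rewrite preimage_setT E.
  exact: (integrable_prod_mul (intf ord0) intg).
Qed.

Definition tset n (v : n.-tuple T) (i : 'I_n) (t : T) : n.-tuple T :=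
  [tuple if j == i then t else tnth v j | j < n].

Lemma measurable_tset n (i : 'I_n) :
  measurable_fun setT (fun z : n.-tuple T * T => tset z.1 i z.2).
Proof.
apply/measurable_fun_tnthP => j /=.
rewrite (_ : _ \o _ = fun z => if j == i then z.2 else tnth z.1 j); last first.
  by apply/funext => z /=; rewrite tnth_mktuple.
case: (j == i); first exact: measurable_snd.
by apply: (measurableT_comp (measurable_tnth j)); exact: measurable_fst.
Qed.

Lemma measurable_tset_line n (v : n.-tuple T) (i : 'I_n) : measurable_fun setT (tset v i).
Proof.
apply/measurable_fun_tnthP => j /=.
rewrite (_ : _ \o _ = fun t => if j == i then t else tnth v j); last first.
  by apply/funext => t /=; rewrite tnth_mktuple.
by case: (j == i).
Qed.

Lemma tset_tcons0 n t s (w : n.-tuple T) : tset (tcons (t, w)) ord0 s = tcons (s, w).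
Proof.
apply: eq_from_tnth => j; rewrite tnth_mktuple.
by case: (unliftP ord0 j) => [k ->|->]; rewrite ?eqxx// ?tnth0// !tnthS.
Qed.

Lemma tset_tconsS n t s (w : n.-tuple T) (i : 'I_n) :
  tset (tcons (t, w)) (lift ord0 i) s = tcons (t, tset w i s).
Proof.
apply: eq_from_tnth => j; rewrite tnth_mktuple.
case: (unliftP ord0 j) => [k ->|->]; rewrite ?tnth0// ?tnthS//.
by rewrite tnth_mktuple (inj_eq lift_inj).
Qed.

Local Open Scope ereal_scope.

Lemma measurable_integral_tset n (i : 'I_n) (f : n.-tuple T -> \bar R) :
  measurable_fun setT f -> (forall v, 0 <= f v) ->
  measurable_fun setT (fun v => \int[P]_t f (tset v i t)).
Proof.
move=> mf f0.
apply: (measurable_fun_fubini_tonelli_F (fun z => f (tset z.1 i z.2))) => //.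
by apply: (measurableT_comp mf); exact: measurable_tset.
Qed.

(** Resampling one coordinate preserves the product law. This gives access to any single coordinate,
    whereas the recursive definition exposes the first one only. When the first coordinate is
    resampled, its old value integrates to 1 and Tonelli restores the order; the other cases follow
    by induction. *)
Lemma ge0_integral_tset n (i : 'I_n) (f : n.-tuple T -> \bar R) :
  measurable_fun setT f -> (forall v, 0 <= f v) ->
  \int[product_prob P n]_v f v =
  \int[product_prob P n]_v \int[P]_t f (tset v i t).
Proof.
elim: n i f => [[]//|n IH] i f mf f0.
have mg := measurable_integral_tset i mf f0.
have mtc := @measurable_tcons _ T n.
rewrite [LHS](ge0_integral_product_probS mf f0).
rewrite [RHS](ge0_integral_product_probS mg); last first.
  by move=> v; apply: integral_ge0 => t _; exact: f0.
case: (unliftP ord0 i) => [k ->|->].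
- apply: eq_integral => t _; rewrite (IH k); last by move=> w; exact: f0.
    by apply: eq_integral => w _; apply: eq_integral => s _; rewrite tset_tconsS.
  apply: (measurableT_comp mf); apply: (measurableT_comp mtc).
  exact: pair1_measurable.
- transitivity (\int[P]_t \int[P]_s \int[product_prob P n]_w f (tcons (s, w))).
    by rewrite integral_cst//= [X in _ * X]probability_setT mule1.
  apply: eq_integral => t _.
  under [RHS]eq_integral do under eq_integral do rewrite tset_tcons0.
  rewrite (fubini_tonelli (fun z => f (tcons z)))//.
  by apply: (measurableT_comp mf).
Qed.

(** As an equality of measures, invariance under resampling extends from nonnegative functions to
    integrable ones of any sign. *)
Lemma product_prob_tset n (i : 'I_n) (A : set (n.-tuple T)) : measurable A ->
  product_prob P n A =
  pushforward (product_prob P n \x P) (fun z => tset z.1 i z.2) A.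
Proof.
move=> mA.
rewrite -[in LHS](setIT A) -(integral_indic (product_prob P n) measurableT)//.
rewrite (ge0_integral_tset i)//; last first.
  by apply/measurable_EFinP; exact: measurable_indic.
have mB : measurable ((fun z : n.-tuple T * T => tset z.1 i z.2) @^-1` A).
  by rewrite -[X in measurable X]setTI; exact: (measurable_tset i).
rewrite /pushforward -[in RHS](setIT (_ @^-1` _)).
rewrite -(integral_indic (product_prob P n \x P) measurableT)//.
rewrite fubini_tonelli1//.
by apply/measurable_EFinP; exact: measurable_indic.
Qed.

Lemma integrable_tset n (i : 'I_n) (f : n.-tuple T -> R) :
  (product_prob P n).-integrable setT (EFin \o f) ->
  (product_prob P n \x P).-integrable setT
    (fun z => (f (tset z.1 i z.2))%:E).
Proof.
move=> /integrableP[mf fi]; apply/integrableP; split.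
  by apply: (measurableT_comp mf); exact: measurable_tset.
rewrite fubini_tonelli1//=.
- rewrite -(ge0_integral_tset i (f := fun v => `|f v|%:E))//.
  have mf' : measurable_fun setT f by exact/measurable_EFinP.
  by apply/measurable_EFinP; apply: (measurableT_comp _ mf').
- have mf' : measurable_fun setT f by exact/measurable_EFinP.
  apply/measurable_EFinP; apply: measurableT_comp => //.
  by apply: (measurableT_comp mf'); exact: measurable_tset.
Qed.

Lemma integral_tset n (i : 'I_n) (f : n.-tuple T -> R) :
  (product_prob P n).-integrable setT (EFin \o f) ->
  \int[product_prob P n]_v (f v)%:E =
  \int[product_prob P n]_v \int[P]_t (f (tset v i t))%:E.
Proof.
move=> intf; have intg := integrable_tset i intf.
have mf : measurable_fun setT (EFin \o f) by case/integrableP: intf.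
rewrite [RHS](integral12_prod_meas1 intg).
have := integral_pushforward (measurable_tset i) mf
  (mu := product_prob P n \x P) intg measurableT.
rewrite preimage_setT /= => <-.
apply: eq_measure_integral => [|mt A mA _]; first exact: measurable_tset.
exact: product_prob_tset.
Qed.

End product_prob_integral.

(** * Gaussian integration by parts *)

Section standard_normal.
Context (R : realType).
Local Notation mu := (@lebesgue_measure R).
Local Notation gamma := (normal_prob (0 : R) 1).
Local Notation rho := (normal_pdf (0 : R) 1).

(** The change of variables used below is expressed with the Radon-Nikodym derivative, which agrees
    with the explicit density only almost everywhere. *)
Let RN_normal : ae_eq mu setT (Radon_Nikodym_SigmaFinite.f gamma mu) (EFin \o rho).
Proof.
have dom := normal_prob_dominates (0 : R) 1.
apply: integral_ae_eq => //.
- exact: Radon_Nikodym_SigmaFinite.f_integrable.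
- by apply/measurable_EFinP; exact: measurable_normal_pdf.
- by move=> A _ mA; rewrite -Radon_Nikodym_SigmaFinite.f_integral.
Qed.

Lemma ge0_integral_normal_prob (f : R -> \bar R) :
  measurable_fun setT f -> (forall x, 0 <= f x)%E ->
  (\int[gamma]_x f x = \int[mu]_x (f x * (rho x)%:E))%E.
Proof.
move=> mf f0; have dom := normal_prob_dominates (0 : R) 1.
rewrite -(Radon_Nikodym_SigmaFinite.change_of_variables dom)//.
apply: ae_eq_integral => //.
- apply: emeasurable_funM => //; apply: (measurable_int mu).
  exact: Radon_Nikodym_SigmaFinite.f_integrable.
- apply: emeasurable_funM => //; apply/measurable_EFinP.
  exact: measurable_normal_pdf.
- exact: ae_eqe_mul2l.
Qed.

Lemma integrable_normal_probP (f : R -> R) : measurable_fun setT f ->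
  gamma.-integrable setT (EFin \o f) <->
  mu.-integrable setT (fun x => (f x * rho x)%:E).
Proof.
move=> mf; have mr := measurable_normal_pdf (0 : R) 1.
have mfr : measurable_fun setT (fun x => (f x * rho x)%:E).
  by apply/measurable_EFinP; exact: measurable_funM.
have E : (\int[gamma]_x `|(f x)%:E| = \int[mu]_x `|(f x * rho x)%:E|)%E.
  rewrite ge0_integral_normal_prob//; last first.
    by apply/measurable_EFinP; exact: measurableT_comp.
  apply: eq_integral => x _; rewrite [in RHS]EFinM abseM.
  by rewrite [X in (_ = _ * X)%E]gee0_abs// lee_fin normal_pdf_ge0.
split=> /integrableP[_ fi]; apply/integrableP.
- by split; [exact: mfr|rewrite -E].
- by split; [exact/measurable_EFinP|rewrite E].
Qed.

Lemma integral_normal_prob (f : R -> R) :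
  gamma.-integrable setT (EFin \o f) ->
  (\int[gamma]_x (f x)%:E = \int[mu]_x (f x * rho x)%:E)%E.
Proof.
move=> intf; have mf : measurable_fun setT (EFin \o f) by case/integrableP: intf.
rewrite integralE [RHS]integralE.
congr (_ - _)%E.
- rewrite ge0_integral_normal_prob//; last exact: measurable_funepos.
  apply: eq_integral => x _; rewrite !funeposE.
  by rewrite maxe_pMl ?mul0e -?EFinM// lee_fin normal_pdf_ge0.
- rewrite ge0_integral_normal_prob//; last exact: measurable_funeneg.
  apply: eq_integral => x _; rewrite !funenegE.
  by rewrite maxe_pMl ?mul0e ?mulNe -?EFinM// lee_fin normal_pdf_ge0.
Qed.

Lemma normal_pdf01E (x : R) : rho x = normal_peak 1 * expR (- (x ^+ 2 / 2)).
Proof.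
rewrite normal_pdfE ?oner_neq0//; congr (_ * expR _).
by rewrite subr0 expr1n mulNr.
Qed.

Lemma normal_prob_opp (f : R -> \bar R) :
  measurable_fun setT f -> (forall x, 0 <= f x)%E ->
  (\int[gamma]_x f (- (x : R))%R = \int[gamma]_x f x)%E.
Proof.
move=> mf f0; rewrite !ge0_integral_normal_prob//; last first.
  by apply: measurableT_comp => //; exact: oppr_measurable.
pose g x := (f x * (rho x)%:E)%E.
have rhoN x : rho (- x) = rho x by rewrite !normal_pdf01E sqrrN.
have mg : measurable_fun setT g.
  by apply: emeasurable_funM => //; apply/measurable_EFinP; exact: measurable_normal_pdf.
transitivity (\int[mu]_x g (- (x : R))%R)%E.
  by apply: eq_integral => x _; rewrite /g rhoN.
transitivity (\int[pushforward mu (-%R : _ -> measurableTypeR R)]_x g x)%E.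
  rewrite ge0_integral_pushforward// => x _.
  by rewrite mule_ge0// lee_fin normal_pdf_ge0.
by apply: eq_measure_integral => A mA _; exact: lebesgue_measureN.
Qed.

Lemma integrable_normal_prob_id : gamma.-integrable setT (EFin \o (id : R -> R)).
Proof.
apply/integrable_normal_probP => //.
(* [`|x| * exp (- x ^ 2 / 2) <= exp (- x ^ 2 / 4)], a Gaussian of variance 2 *)
pose s : R := Num.sqrt 2.
have s0 : s != 0 by rewrite gt_eqF// sqrtr_gt0.
have int2 := integrable_normal_pdf 0 s.
apply: (le_integrable measurableT _ _
  (integrableZl measurableT (normal_peak 1 / normal_peak s) int2)).
  by apply/measurable_EFinP; apply: measurable_funM => //; exact: measurable_normal_pdf.
move=> x _; rewrite -EFinM lee_fin /=.
have sE : normal_pdf 0 s x = normal_peak s * normal_fun 0 s x by rewrite normal_pdfE.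
rewrite normal_pdf01E sE /normal_fun subr0 [X in _ <= `|X|]mulrA.
rewrite divfK ?gt_eqF ?normal_peak_gt0// mulrCA normrM [leRHS]normrM ler_wpM2l//.
rewrite normrM !(@ger0_norm _ (expR _)) ?expR_ge0//.
have -> : - x ^+ 2 / (s ^+ 2 *+ 2) = x ^+ 2 / 4 - x ^+ 2 / 2.
  by rewrite sqr_sqrtr//; field.
rewrite expRD ler_wpM2r ?expR_ge0//.
(* What remains is [|x| <= 1 + x ^ 2 / 4], that is [0 <= (x / 2 - 1) ^ 2] and
   [0 <= (x / 2 + 1) ^ 2]. *)
apply: le_trans (expR_ge1Dx _); rewrite ler_norml.
have := sqr_ge0 (x / 2 - 1); have := sqr_ge0 (x / 2 + 1); nra.
Qed.

(** Carries the fundamental theorem of calculus from compact intervals to the whole line. *)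
Lemma cvg_integral_symmetric_itv (f : R -> R) : mu.-integrable setT (EFin \o f) ->
  ((\int[mu]_(x in `[(- n%:R)%R, n%:R]) (f x)%:E)%E @[n --> \oo] --> (\int[mu]_x (f x)%:E)%E).
Proof.
move=> intf.
have mf : measurable_fun setT (EFin \o f) by case/integrableP: intf.
pose f_ (n : nat) := ((EFin \o f) \_ (`[- (n%:R : R), n%:R]%classic : set R)).
have [|//||||_ _] := @dominated_convergence _ _ R mu setT measurableT f_
   (EFin \o f) (abse \o (EFin \o f)).
- move=> n; apply/(measurable_restrictT _ _).1 => //.
  exact: measurable_funTS.
- apply: aeW => x _; apply: cvg_near_cst.
  near=> n; rewrite /f_ patchE mem_set//= in_itv/= -ler_norml.
  by near: n; exact: nbhs_infty_ger.
- exact: integrable_abse.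
- apply: aeW => x n _ /=; rewrite /f_ patchE; case: ifP => //= _.
  by rewrite normr0 lee_fin.
- rewrite [X in X @ _ --> _](_ : _ = fun n : nat =>
    \int[mu]_(x in `[(- n%:R)%R, n%:R]) (f x)%:E)%E//.
  by apply/funext => n; rewrite [RHS]integral_mkcond.
Unshelve. all: end_near. Qed.

Lemma is_derive_normal_pdf01 (x : R) : is_derive x 1 rho (- x * rho x).
Proof.
rewrite (_ : rho = fun x => normal_peak 1 * expR (- (x ^+ 2 / 2))); last first.
  by apply/funext => y; exact: normal_pdf01E.
apply: is_derive_eq.
by rewrite /GRing.scale/=; field.
Qed.

(** Stein's identity. The derivative of [F * rho] is [(f x - x * F x) * rho x], so the claim is that
    this derivative has integral 0: its integral over [[-n, n]] is a boundary term that vanishes in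
    the limit. The common bound [M] gives both integrability and the decay at infinity. *)
Lemma normal_prob_by_parts (F f : R -> R) (M : R) :
  (forall x : R, is_derive x 1 F (f x)) -> continuous f ->
  (forall x, `|F x| <= M) -> (forall x, `|f x| <= M) ->
  (\int[gamma]_x (f x)%:E = \int[gamma]_x (x * F x)%:E)%E.
Proof.
move=> dF cf FM fM.
have cF : continuous F.
  move=> x; apply/differentiable_continuous/derivable1_diffP.
  by case: (dF x).
have mF : measurable_fun setT F by exact: continuous_measurable_fun.
have mf : measurable_fun setT f by exact: continuous_measurable_fun.
have M0 : 0 <= M := le_trans (normr_ge0 _) (FM 0).
have intf : gamma.-integrable setT (EFin \o f).
  apply: measurable_bounded_integrable => //.
    by rewrite [X in (X < _)%E]probability_setT ltry.
  exists M; split => [|y My]; [exact: ger0_real|].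
  by move=> x _ /=; rewrite (le_trans (fM x))// ltW.
have intxF : gamma.-integrable setT (EFin \o (fun x : R => x * F x)).
  apply: (le_integrable measurableT _ _
    (integrableZl measurableT M integrable_normal_prob_id)).
    by apply/measurable_EFinP; exact: measurable_funM.
  move=> x _ /=; rewrite lee_fin !normrM mulrC ler_wpM2r//.
  by rewrite (ger0_norm M0).
pose g x := (f x - x * F x) * rho x.
have intg : mu.-integrable setT (EFin \o g).
  apply/integrable_normal_probP.
    by apply: measurable_funB => //; exact: measurable_funM.
  exact: (integrableB measurableT intf intxF).
have dG (x : R) : is_derive x 1 (F * rho) (g x).
  have := is_derive_normal_pdf01 x; have := dF x => d1 d2.
  apply: is_derive_eq; rewrite /g /GRing.scale/=; ring.
have cr : continuous rho by apply: continuous_normal_pdf; rewrite oner_neq0.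
have cG : continuous (F * rho) by move=> x; apply: cvgM; [exact: cF|exact: cr].
have cg : continuous g.
  move=> x; apply: cvgM; last exact: cr.
  by apply: cvgB; [exact: cf|apply: cvgM; [exact: cvg_id|exact: cF]].
suff : (\int[mu]_x (g x)%:E = 0)%E.
  rewrite -[LHS](integral_normal_prob (f := fun x => f x - x * F x)); last first.
    exact: (integrableB measurableT intf intxF).
  under eq_integral do rewrite EFinB.
  rewrite integralB//= => /eqP; rewrite sube_eq ?add0e; last 2 first.
  - exact: (integrable_fin_num measurableT).
  - by rewrite fin_num_adde_defl//; exact: (integrable_fin_num measurableT).
  by move/eqP.
have /cvg_lim <-// := cvg_integral_symmetric_itv intg.
apply/cvg_lim => //.
(* [exp (- t ^ 2 / 2) <= exp (1 / 2 - `|t|)] because [0 <= (`|t| - 1) ^ 2] *)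
pose K := M * (normal_peak 1 * expR (2^-1)).
have K0 : 0 <= K by rewrite !mulr_ge0 ?normal_peak_ge0 ?expR_ge0.
have GK (t : R) : `|(F * rho) t| <= K * expR (- `|t|).
  rewrite normrM normal_pdf01E normrM (ger0_norm (normal_peak_ge0 _)).
  rewrite (ger0_norm (expR_ge0 _)) /K -!mulrA ler_pM ?mulr_ge0 ?normal_peak_ge0 ?expR_ge0//.
  rewrite ler_wpM2l ?normal_peak_ge0// -expRD ler_expR.
  have := sqr_ge0 (`|t| - 1); have := real_normK (num_real t); nra.
have limK : K * expR (- n%:R) @[n --> \oo] --> (0 : R).
  by rewrite -(mulr0 K); apply: cvgMr; exact: cvgn_expR.
have lim0 (s : nat -> R) : (forall n, `|s n| = n%:R) ->
    (F * rho) (s n) @[n --> \oo] --> (0 : R).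
  move=> sE; apply: norm_cvg0.
  apply: (squeeze_cvgr _ (cvg_cst 0) limK); apply: nearW => n.
  by rewrite normr_ge0/= (le_trans (GK _))// sE.
suff : ((F * rho) n%:R - (F * rho) (- n%:R))%:E @[n --> \oo] --> (0 : R)%:E.
  apply: cvg_trans.
  apply: near_eq_cvg; near=> n.
  have n0 : (0 < n%:R :> R) by rewrite ltr0n; near: n; exact: nbhs_infty_gt.
  rewrite EFinB (@continuous_FTC2 _ g (F * rho))//.
  - by rewrite -subr_gt0 opprK addr_gt0.
  - exact: continuous_subspaceT.
  - split.
    + by move=> x _; case: (dG x).
    + by apply: cvg_at_right_filter; exact: cG.
    + by apply: cvg_at_left_filter; exact: cG.
  - by move=> x _; rewrite derive1E; exact: derive_val.
apply: cvg_EFin; first exact: nearW.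
have L1 := lim0 (fun n => n%:R) (fun n => ger0_norm (ler0n _ _)).
have L2 := lim0 (fun n => - n%:R) (fun n => etrans (normrN _) (ger0_norm (ler0n _ _))).
have L3 := cvgB L1 L2.
rewrite subr0 in L3.
exact: L3.
Unshelve. all: end_near. Qed.

End standard_normal.

(** * Moments of the uniform measure on the sphere *)

(** The derivation is an abstract relation, so that the rule serves both for derivatives along a
    curve and for the formal rotation [is_rot]. *)
Lemma leibniz_prod (A : comPzRingType) (D : A -> A -> Prop) :
  D 1 0 ->
  (forall a a' b b', D a a' -> D b b' -> D (a * b) (a' * b + a * b')) ->
  forall (I : finType) (P : pred I) (f f' : I -> A),
  (forall i, P i -> D (f i) (f' i)) ->
  D (\prod_(i | P i) f i) (\sum_(i | P i) f' i * \prod_(k | P k && (k != i)) f k).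
Proof.
move=> D1 DM I P f f' Df.
suff H s : uniq s ->
    D (\prod_(i <- s | P i) f i)
      (\sum_(i <- s | P i) f' i * \prod_(k <- s | P k && (k != i)) f k).
  by apply: H; exact: index_enum_uniq.
elim: s => [|x s IH] /=; first by rewrite !big_nil.
move=> /andP[xs us]; rewrite big_cons [in X in D _ X]big_cons.
have sE i : i \in s -> (x != i) by apply: contraTneq => <-.
case: ifPn => Px.
- have -> : f' x * \prod_(k <- x :: s | P k && (k != x)) f k +
      \sum_(j <- s | P j) f' j * \prod_(k <- x :: s | P k && (k != j)) f k =
      f' x * (\prod_(j <- s | P j) f j) +
      f x * \sum_(j <- s | P j) f' j * \prod_(k <- s | P k && (k != j)) f k.
    rewrite big_cons eqxx andbF; congr (_ * _ + _).
      rewrite big_seq_cond [RHS]big_seq_cond; apply: eq_bigl => i.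
      by case si: (i \in s) => //=; rewrite eq_sym sE// andbT.
    rewrite mulr_sumr big_seq_cond [RHS]big_seq_cond.
    apply: eq_bigr => i /andP[si Pi].
    by rewrite big_cons Px sE//= mulrCA.
  by apply: DM; [exact: Df|exact: IH].
- rewrite (_ : \sum_(j <- s | P j) _ =
      \sum_(j <- s | P j) f' j * \prod_(k <- s | P k && (k != j)) f k); first exact: IH.
  by apply: eq_bigr => i _; rewrite big_cons (negbTE Px).
Qed.

Section monomials.
Context (R : realType) (N : nat).
Implicit Types (a b : 'I_N -> nat) (p : N.-tuple R).

Definition mono a p : R := \prod_(k < N) tnth p k ^+ a k.

Definition exp_inc a (i : 'I_N) : 'I_N -> nat := fun k => (a k + (k == i))%N.

(** At exponent 0 the truncated subtraction leaves [a] unchanged. In the derivatives below this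
    value is always multiplied by the coefficient [a i], which is then 0. *)
Definition exp_dec a (i : 'I_N) : 'I_N -> nat := fun k => (a k - (k == i))%N.

Lemma mono0 p : mono (fun=> 0%N) p = 1.
Proof. by apply: big1 => k _; rewrite expr0. Qed.

Lemma monoD a b p : mono (fun k => a k + b k)%N p = mono a p * mono b p.
Proof. by rewrite /mono -big_split/=; apply: eq_bigr => k _; rewrite exprD. Qed.

Lemma mono_inc a i p : mono (exp_inc a i) p = tnth p i * mono a p.
Proof.
rewrite monoD mulrC; congr (_ * _).
rewrite /mono (bigD1 i)//= eqxx expr1 big1 ?mulr1// => k ki.
by rewrite (negbTE ki) expr0.
Qed.

Lemma mono_dec a i p : (a i)%:R * mono (exp_dec a i) p =
  (tnth p i ^+ (a i).-1 *+ a i) * \prod_(k | k != i) tnth p k ^+ a k.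
Proof.
rewrite /mono (bigD1 i)//= /exp_dec eqxx subn1 mulrA mulr_natl.
congr (_ * _); apply: eq_bigr => k ki.
by rewrite (negbTE ki) subn0.
Qed.

Lemma measurable_mono a : measurable_fun setT (mono a).
Proof.
apply: measurable_prod => k _; apply: measurable_funX; exact: measurable_tnth.
Qed.

Lemma mono_bound a p : (forall k, `|tnth p k| <= 1) -> `|mono a p| <= 1.
Proof.
move=> p1; rewrite normr_prod; apply: prodr_ile1 => k _.
by rewrite normr_ge0/= normrX exprn_ile1.
Qed.

End monomials.

(** * The sphere measure as the law of a Gaussian direction *)

Section direction.
Context (R : realType) (N : nat).
Local Notation gaussN := (product_prob (normal_prob (0 : R) 1) N).
Local Notation sphere := (uniform_sphere R N).
Implicit Types (v : N.-tuple (measurableTypeR R)) (i j k : 'I_N).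

Lemma tnth_direction v k : tnth (direction v) k = tnth v k / Num.sqrt (dot v v).
Proof. by rewrite tnth_mktuple. Qed.

Lemma dot_ge v k : tnth v k ^+ 2 <= dot v v.
Proof.
rewrite /dot (bigD1 k)//= -expr2 lerDl sumr_ge0// => l _.
by rewrite -expr2 sqr_ge0.
Qed.

Lemma direction_bound v k : `|tnth (direction v) k| <= 1.
Proof.
rewrite tnth_direction normrM normfV (ger0_norm (sqrtr_ge0 _)).
have [->|s0] := eqVneq (Num.sqrt (dot v v)) 0; first by rewrite invr0 mulr0.
rewrite ler_pdivrMr ?mul1r ?lt_def ?s0 ?sqrtr_ge0//.
by rewrite -sqrtr_sqr ler_wsqrtr// dot_ge.
Qed.

(** The cube replaces the sphere because [direction 0 = 0] is not a unit vector: every value of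
    [direction] lies in the cube, so integrability requires no almost-everywhere argument. *)
Definition cube_bounded (f : N.-tuple R -> R) :=
  exists M, forall p, (forall k, `|tnth p k| <= 1) -> `|f p| <= M.

Lemma integrable_direction (f : N.-tuple R -> R) :
  measurable_fun setT f -> cube_bounded f ->
  gaussN.-integrable setT (EFin \o (f \o @direction R N)).
Proof.
move=> mf [M fM]; apply: measurable_bounded_integrable => //.
- by rewrite [X in (X < _)%E]probability_setT ltry.
- by apply: measurableT_comp => //; exact: measurable_direction.
- exists M; split => [|y My v _ /=].
    by rewrite realE (le_trans (normr_ge0 _) (fM [tuple 0 | _ < N] _))// => k;
      rewrite tnth_mktuple normr0.
  by rewrite (le_trans (fM _ _) (ltW My))// => k; exact: direction_bound.
Qed.

Lemma integrable_sphere (f : N.-tuple R -> R) :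
  measurable_fun setT f -> cube_bounded f -> sphere.-integrable setT (EFin \o f).
Proof.
move=> mf bf.
apply: (integrable_pushforward (@measurable_direction R N) (mu := gaussN)) => //.
  exact/measurable_EFinP.
by rewrite preimage_setT; exact: integrable_direction.
Qed.

Lemma integral_sphere (f : N.-tuple R -> R) :
  measurable_fun setT f -> cube_bounded f ->
  (\int[sphere]_p (f p)%:E = \int[gaussN]_v (f (direction v))%:E)%E.
Proof.
move=> mf bf.
rewrite (integral_pushforward (@measurable_direction R N) (mu := gaussN))//.
- exact/measurable_EFinP.
- by rewrite preimage_setT; exact: integrable_direction.
Qed.

Definition sflip (i : 'I_N) (p : N.-tuple R) : N.-tuple R :=
  [tuple if k == i then - tnth p k else tnth p k | k < N].

Lemma measurable_sflip i : measurable_fun setT (sflip i).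
Proof.
apply/measurable_fun_tnthP => k.
rewrite (_ : _ \o _ = fun p => if k == i then - tnth p k else tnth p k); last first.
  by apply/funext => p /=; rewrite tnth_mktuple.
case: (k == i); last exact: measurable_tnth.
by apply: measurableT_comp => //; exact: measurable_tnth.
Qed.

Lemma direction_sflip i v : direction (sflip i v) = sflip i (direction v).
Proof.
have E : dot (sflip i v) (sflip i v) = dot v v.
  by apply: eq_bigr => k _; rewrite tnth_mktuple; case: ifP => // _; rewrite mulrNN.
apply: eq_from_tnth => k; rewrite tnth_direction E !tnth_mktuple.
by case: ifP => // _; rewrite mulNr.
Qed.

Lemma sflip_tset i v (t : R) : sflip i (tset v i t) = tset v i (- t).
Proof.
apply: eq_from_tnth => k; rewrite !tnth_mktuple.
by case: (k == i).
Qed.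

(* [sflip i] between the copies of R^N on which [normal_prob] lives. *)
Definition gflip i : N.-tuple (measurableTypeR R) -> N.-tuple (measurableTypeR R) :=
  sflip i.

Lemma measurable_gflip i : measurable_fun setT (gflip i).
Proof. exact: measurable_sflip. Qed.

(** After resampling coordinate [i], this is the evenness of the one-dimensional Gaussian. *)
Lemma gauss_gflip i (A : set (N.-tuple (measurableTypeR R))) : measurable A ->
  gaussN (gflip i @^-1` A) = gaussN A.
Proof.
move=> mA.
have mB : measurable (gflip i @^-1` A).
  by rewrite -[X in measurable X]setTI; exact: (measurable_gflip i).
rewrite -[in LHS](setIT (_ @^-1` _)) -[in RHS](setIT A).
rewrite -!(integral_indic gaussN measurableT)//.
rewrite [LHS](ge0_integral_tset _ i); last 2 first.
- by apply/measurable_EFinP; exact: measurable_indic.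
- by move=> v; rewrite lee_fin.
rewrite [RHS](ge0_integral_tset _ i); last 2 first.
- by apply/measurable_EFinP; exact: measurable_indic.
- by move=> v; rewrite lee_fin.
apply: eq_integral => v _.
pose g (t : R) := (\1_A (tset v i t) : R)%:E.
rewrite -[RHS](normal_prob_opp (f := g)).
- apply: eq_integral => t _; rewrite /g -sflip_tset.
  by rewrite !indicE; congr ((_ : bool)%:R%:E); apply/idP/idP; rewrite !inE.
- apply/measurable_EFinP; apply: measurableT_comp; first exact: measurable_indic.
  exact: measurable_tset_line.
- by move=> t; rewrite lee_fin.
Qed.

Lemma integral_sflip i (f : N.-tuple R -> R) :
  measurable_fun setT f -> cube_bounded f ->
  (\int[sphere]_p (f (sflip i p))%:E = \int[sphere]_p (f p)%:E)%E.
Proof.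
move=> mf bf.
have mfl : measurable_fun setT (f \o sflip i).
  by apply: measurableT_comp => //; exact: measurable_sflip.
have bfl : cube_bounded (f \o sflip i).
  have [M fM] := bf; exists M => p p1; apply: fM => k.
  by rewrite tnth_mktuple; case: ifP => // _; rewrite normrN.
rewrite (integral_sphere mfl bfl) (integral_sphere mf bf).
under eq_integral do rewrite /= -direction_sflip -/(gflip i _).
have := integral_pushforward (measurable_gflip i) (mu := gaussN)
  (f := fun v => (f (direction v))%:E) (D := setT).
rewrite preimage_setT /= => <-//.
- by apply: eq_measure_integral => [|mt A mA _]; [exact: measurable_gflip|exact: gauss_gflip].
- by apply/measurable_EFinP; apply: (measurableT_comp mf); exact: measurable_direction.
- move: (integrable_direction mfl bfl); congr (_.-integrable _ _).
  by apply/funext => v /=; rewrite -direction_sflip.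
Qed.

End direction.

(** * Infinitesimal rotation invariance of the sphere measure *)

Section sphere_rotation.
Context (R : realType) (N : nat).
Local Notation gaussN := (product_prob (normal_prob (0 : R) 1) N).
Local Notation sphere := (uniform_sphere R N).

(* Differentiability is tested along curves, which avoids a topology on
   tuples. *)
Definition has_grad (F : N.-tuple R -> R) (G : 'I_N -> N.-tuple R -> R) :=
  forall q q' : 'I_N -> R -> R,
  (forall k (t : R), is_derive t 1 (q k) (q' k t)) ->
  forall t : R, is_derive t 1 (fun s => F [tuple q k s | k < N])
    (\sum_k q' k t * G k [tuple q k t | k < N]).

Definition curve_continuous (F : N.-tuple R -> R) :=
  forall q : 'I_N -> R -> R, (forall k, continuous (q k)) ->
  continuous (fun s => F [tuple q k s | k < N]).

Variables (F : N.-tuple R -> R) (G : 'I_N -> N.-tuple R -> R).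
Hypotheses (FG : has_grad F G) (cG : forall k, curve_continuous (G k))
  (mF : measurable_fun setT F) (mG : forall k, measurable_fun setT (G k))
  (bF : cube_bounded F) (bG : forall k, cube_bounded (G k)).

Let euler p := \sum_k tnth p k * G k p.
(* The derivative of [F \o direction] with respect to the [i]-th coordinate is
   [tangent i] at the direction, divided by the norm. *)
Let tangent i p := G i p - tnth p i * euler p.

Let measurable_tangent i : measurable_fun setT (tangent i).
Proof.
apply: measurable_funB => //; apply: measurable_funM; first exact: measurable_tnth.
by apply: measurable_sum => k; apply: measurable_funM => //; exact: measurable_tnth.
Qed.

Let bounded_euler : cube_bounded euler.
Proof.
have /choice[M GM] := bG; exists (\sum_k M k) => p p1.
rewrite (le_trans (ler_norm_sum _ _ _))// ler_sum// => k _.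
by rewrite normrM -[leRHS]mul1r ler_pM// GM.
Qed.

Let bounded_tangent i : cube_bounded (tangent i).
Proof.
have [M EM] := bounded_euler; have [M' GM] := bG i; exists (M' + M) => p p1.
rewrite (le_trans (ler_normB _ _))// lerD ?GM// normrM -[leRHS]mul1r.
by rewrite ler_pM// EM.
Qed.

Section one_variable.
Variables (v : N.-tuple (measurableTypeR R)) (i j : 'I_N).
Hypotheses (ij : i != j) (vi0 : tnth v i != 0).

Let S := \sum_(k | k != j) tnth v k ^+ 2.
Let r (t : R) : R := Num.sqrt (S + t ^+ 2).
Let q k (t : R) : R := (if k == j then t else tnth v k) / r t.

Let S_gt0 : 0 < S.
Proof.
rewrite /S (bigD1 i)//= ltr_wpDr//; last by rewrite exprn_even_gt0.
by apply: sumr_ge0 => k _; exact: sqr_ge0.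
Qed.

Let St_gt0 t : 0 < S + t ^+ 2.
Proof. by rewrite ltr_wpDr// sqr_ge0. Qed.

Let r_gt0 t : 0 < r t.
Proof. by rewrite sqrtr_gt0. Qed.

Let dirE (t : R) : direction (tset v j t) = [tuple q k t | k < N].
Proof.
apply: eq_from_tnth => k; rewrite !tnth_mktuple /q; congr (_ / Num.sqrt _).
rewrite /dot (bigD1 j)//= addrC tnth_mktuple eqxx expr2; congr (_ + _).
by apply: eq_bigr => l lj; rewrite tnth_mktuple (negbTE lj) expr2.
Qed.

Let derive_r (t : R) : is_derive t 1 r (t / r t).
Proof.
have d1 : is_derive t 1 (fun t => S + t ^+ 2) (t *+ 2).
  have := is_deriveD (is_derive_cst S t (1 : R)) (is_deriveX 2 (is_derive_id t (1 : R))).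
  by congr (is_derive _ _ _ _); rewrite add0r /GRing.scale/= mulr1 expr1 mulr_natl.
have d2 := is_derive1_sqrt (St_gt0 t).
have := @is_derive1_comp _ Num.sqrt (fun t : R => S + t ^+ 2) t _ _ d2 d1.
congr (is_derive _ _ _ _).
by rewrite /r -mulr_natl; field; rewrite gt_eqF ?r_gt0.
Qed.

Let derive_q k (t : R) : is_derive t 1 (q k) (((k == j)%:R - q k t * q j t) / r t).
Proof.
have rt0 : r t != 0 by rewrite gt_eqF.
have dn : is_derive t 1 (fun t : R => if k == j then t else tnth v k) ((k == j)%:R).
  by case: (k == j); [exact: is_derive_id|exact: is_derive_cst].
have dV := is_deriveV rt0 (derive_r t).
have := is_deriveM dn dV; congr (is_derive _ _ _ _).
by rewrite /q eqxx /GRing.scale/=; field.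
Qed.

Let cont_q k : continuous (q k).
Proof.
move=> t; apply/differentiable_continuous/derivable1_diffP.
by case: (derive_q k t).
Qed.

Let cont_tq k : continuous (fun t => tnth [tuple q l t | l < N] k).
Proof.
rewrite (_ : (fun t => _) = q k); first exact: cont_q.
by apply/funext => t; rewrite tnth_mktuple.
Qed.

(** Only coordinate [j] moves. As [tnth v i] is nonzero and stays fixed, the line avoids the origin,
    where [direction] is singular, and the norm [r t] is at least [sqrt S > 0]. Stein's identity is
    applied to [H], that is [tnth v i] times [F] at the direction; dividing [tnth v i] by the norm
    in the derivative produces the [i]-th component of the direction. *)
Lemma sphere_by_parts_line :
  (\int[normal_prob (0 : R) 1]_t
     (tnth (direction (tset v j t)) i * tangent j (direction (tset v j t)))%:E =
   \int[normal_prob (0 : R) 1]_t (tnth (tset v j t) i * tnth (tset v j t) j *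
     F (direction (tset v j t)))%:E)%E.
Proof.
pose f t := tnth v i * (tangent j [tuple q k t | k < N] / r t).
pose H t := tnth v i * F [tuple q k t | k < N].
have vtj t : tnth (tset v j t) j = t by rewrite tnth_mktuple eqxx.
have vti t : tnth (tset v j t) i = tnth v i by rewrite tnth_mktuple (negbTE ij).
transitivity (\int[normal_prob (0 : R) 1]_t (f t)%:E)%E.
  apply: eq_integral => t _; rewrite /f dirE tnth_mktuple /q (negbTE ij).
  by congr (_%:E); rewrite -mulrA [in RHS](mulrC _ (r t)^-1).
transitivity (\int[normal_prob (0 : R) 1]_t (t * H t)%:E)%E; last first.
  by apply: eq_integral => t _; rewrite /H vti vtj dirE mulrCA mulrA.
have q1 t k : `|tnth [tuple q k t | k < N] k| <= 1.
  by rewrite -dirE; exact: direction_bound.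
have [M1 FM] := bF; have [M2 TM] := bounded_tangent j.
(* The first argument of the maximum bounds [H]; the second bounds its derivative, through
   [r t >= sqrt S]. *)
apply: (@normal_prob_by_parts _ _ _
  (Num.max (`|tnth v i| * M1) (`|tnth v i| * (M2 / Num.sqrt S)))).
- move=> t; have dF := FG derive_q t.
  have := is_deriveZ (tnth v i) dF; congr (is_derive _ _ _ _).
  rewrite /f /GRing.scale/=; congr (_ * _); rewrite /tangent /euler.
  rewrite tnth_mktuple mulrBl mulr_sumr mulr_suml.
  transitivity (\sum_k ((k == j)%:R * G k [tuple q k t | k < N] / r t -
      q j t * (tnth [tuple q k t | k < N] k * G k [tuple q k t | k < N]) / r t)).
    by apply: eq_bigr => k _; rewrite tnth_mktuple; ring.
  rewrite sumrB (bigD1 j)//= eqxx mul1r big1 ?addr0// => k kj.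
  by rewrite (negbTE kj) !mul0r.
- move=> t; apply: cvgM; first exact: cvg_cst.
  apply: cvgM; last first.
    apply: cvgV; first by rewrite gt_eqF.
    by apply/differentiable_continuous/derivable1_diffP; case: (derive_r t).
  apply: cvgB; first exact: cG.
  apply: cvgM.
    exact: cont_tq.
  apply: cvg_big => [|k _]; first exact: add_continuous.
  apply: cvgM; last exact: cG.
  exact: cont_tq.
- move=> t; rewrite le_max; apply/orP; left.
  by rewrite normrM ler_wpM2l// FM.
- move=> t; rewrite le_max; apply/orP; right.
  rewrite normrM ler_wpM2l// normrM ler_pM// ?TM//.
  rewrite normfV (ger0_norm (sqrtr_ge0 _)) lef_pV2 ?posrE ?sqrtr_gt0//.
  by rewrite ler_wsqrtr// lerDl sqr_ge0.
Qed.

End one_variable.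

Section rotation.
Variables i j : 'I_N.
Hypothesis ij : i != j.

Let integrable_quadratic : gaussN.-integrable setT
  (fun v => (tnth v i * tnth v j * F (direction v))%:E).
Proof.
have [M FM] := bF.
pose f k (t : R) : R := if (k == i) || (k == j) then t else 1.
have intf k : (normal_prob (0 : R) 1).-integrable setT (EFin \o f k).
  have -> : f k = if (k == i) || (k == j) then id else cst 1.
    by apply/funext => t; rewrite /f; case: ifP.
  case: ifP => _; first exact: integrable_normal_prob_id.
  exact: finite_measure_integrable_cst.
have fE (v : N.-tuple (measurableTypeR R)) : \prod_k f k (tnth v k) = tnth v i * tnth v j.
  rewrite (bigD1 i)//= (bigD1 j) ?(eq_sym j)//= /f !eqxx orbT/= big1 ?mulr1// => k.
  by move=> /andP[/negbTE-> /negbTE->].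
have := integrable_product_prob intf.
under eq_fun do rewrite fE.
move=> intE; apply: (le_integrable measurableT _ _ (integrableZl measurableT M intE)).
  apply/measurable_EFinP; apply: measurable_funM.
    by apply: measurable_funM; exact: measurable_tnth.
  by apply: (measurableT_comp mF); exact: measurable_direction.
move=> v _; rewrite -EFinM lee_fin /= [leLHS]normrM [leRHS]normrM [leLHS]mulrC ler_wpM2r//.
rewrite (le_trans (FM _ _) (ler_norm _))// => k; exact: direction_bound.
Qed.

Let bounded_mul_tnth (k : 'I_N) (f : N.-tuple R -> R) :
  cube_bounded f -> cube_bounded (fun p => tnth p k * f p).
Proof.
move=> [M fM]; exists M => p p1; rewrite normrM -[leRHS]mul1r ler_pM ?fM//.
Qed.

(* The right-hand side is symmetric in [a] and [b]. *)
Let half_rotation a b : a != b -> gaussN.-integrable setT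
  (fun v => (tnth v a * tnth v b * F (direction v))%:E) ->
  (\int[sphere]_p (tnth p a * tangent b p)%:E =
   \int[gaussN]_v (tnth v a * tnth v b * F (direction v))%:E)%E.
Proof.
move=> ab intq.
have mt : measurable_fun setT (fun p : N.-tuple R => tnth p a * tangent b p).
  by apply: measurable_funM => //; exact: measurable_tnth.
have bt := bounded_mul_tnth a (bounded_tangent b).
rewrite integral_sphere//.
rewrite [LHS](integral_tset b); last exact: (integrable_direction mt bt).
rewrite [RHS](integral_tset b); last exact: intq.
apply: eq_integral => v _.
(* If [tnth v a = 0] the line meets the origin or may do so, but then both integrands are
   identically 0. *)
have [va0|va0] := eqVneq (tnth v a) 0; last exact: sphere_by_parts_line.
by apply: eq_integral => t _; rewrite tnth_direction !tnth_mktuple (negbTE ab) va0 !mul0r.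
Qed.

(** The rotation field is tangent to the sphere. Splitting each [G] into its tangential part and its
    radial part, the tangential integrals both equal the Gaussian mean of [v_i * v_j * F], and the
    radial integrands contain [p_i * p_j * euler p]; both expressions are symmetric in [i] and
    [j]. *)
Lemma sphere_rotation :
  (\int[sphere]_p (tnth p i * G j p)%:E = \int[sphere]_p (tnth p j * G i p)%:E)%E.
Proof.
have intq := integrable_quadratic.
have Hij := half_rotation ij intq.
have Hji : (\int[sphere]_p (tnth p j * tangent i p)%:E =
   \int[gaussN]_v (tnth v i * tnth v j * F (direction v))%:E)%E.
  rewrite half_rotation; first by apply: eq_integral => v _; rewrite (mulrC (tnth v j)).
    by rewrite eq_sym.
  by under eq_fun do rewrite (mulrC (tnth _ j)).
have mt k l : measurable_fun setT (fun p : N.-tuple R => tnth p k * tangent l p).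
  by apply: measurable_funM => //; exact: measurable_tnth.
have me k l : measurable_fun setT (fun p : N.-tuple R => tnth p k * (tnth p l * euler p)).
  apply: measurable_funM; first exact: measurable_tnth.
  apply: measurable_funM; first exact: measurable_tnth.
  by apply: measurable_sum => m; apply: measurable_funM => //; exact: measurable_tnth.
have be k l : cube_bounded (fun p => tnth p k * (tnth p l * euler p)).
  by do 2 apply: bounded_mul_tnth; exact: bounded_euler.
have split k l : (\int[sphere]_p (tnth p k * G l p)%:E =
    \int[sphere]_p (tnth p k * tangent l p)%:E +
    \int[sphere]_p (tnth p k * (tnth p l * euler p))%:E)%E.
  rewrite -integralD//.
  - by apply: eq_integral => p _; rewrite -EFinD -mulrDr subrK.
  - by apply: (integrable_sphere (mt k l)); exact: bounded_mul_tnth.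
  - exact: (integrable_sphere (me k l) (be k l)).
rewrite !split Hij Hji; congr (_ + _)%E.
by apply: eq_integral => p _; rewrite mulrCA.
Qed.

End rotation.

End sphere_rotation.

Section sphere_moments.
Context (R : realType) (N : nat).
Local Notation sphere := (uniform_sphere R N).
Variables (h : R) (j : 'I_N).
Implicit Types (a : 'I_N -> nat) (p : N.-tuple R).

Definition mono_exp a p : R := mono a p * expR (h * tnth p j).

Lemma measurable_mono_exp a : measurable_fun setT (mono_exp a).
Proof.
apply: measurable_funM; first exact: measurable_mono.
apply: measurableT_comp => //; apply: measurable_funM => //.
exact: measurable_tnth.
Qed.

Lemma bounded_mono_exp a : cube_bounded (mono_exp a).
Proof.
exists (expR `|h|) => p p1; rewrite normrM -[leRHS]mul1r ler_pM ?mono_bound//.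
rewrite ger0_norm ?expR_ge0// ler_expR (le_trans (ler_norm _))// normrM.
by rewrite ler_piMr.
Qed.

Lemma curve_continuous_mono_exp a : curve_continuous (mono_exp a).
Proof.
move=> q cq t.
have ct k : tnth [tuple q l s | l < N] k @[s --> t] --> tnth [tuple q l t | l < N] k.
  rewrite (_ : (fun s => _) = q k); last by apply/funext => s; rewrite tnth_mktuple.
  by rewrite tnth_mktuple; exact: cq.
apply: cvgM.
- apply: cvg_big => [|k _]; first exact: mul_continuous.
  apply: (cvg_comp (fun s => tnth [tuple q l s | l < N] k) (fun x => x ^+ a k)).
    exact: ct.
  exact: exprn_continuous.
- apply: (cvg_comp (fun s => h * tnth [tuple q l s | l < N] j) expR); last exact: continuous_expR.
  by apply: cvgM; [exact: cvg_cst|exact: ct].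
Qed.

Definition grad_mono_exp a (k : 'I_N) p : R :=
  (a k)%:R * mono_exp (exp_dec a k) p + h * (k == j)%:R * mono_exp a p.

Lemma has_grad_mono_exp a : has_grad (mono_exp a) (grad_mono_exp a).
Proof.
move=> q q' dq t.
have d1 : is_derive t 1 (fun s => mono a [tuple q k s | k < N])
   (\sum_k q' k t * ((a k)%:R * mono (exp_dec a k) [tuple q k t | k < N])).
  pose D (f f' : R -> R) := forall s : R, is_derive s 1 f (f' s).
  have D1 : D 1 0 by move=> s; exact: is_derive_cst.
  have DM f f' g g' : D f f' -> D g g' -> D (f * g) (f' * g + f * g').
    move=> df dg s; have := is_deriveM (df s) (dg s); congr (is_derive _ _ _ _).
    by rewrite /GRing.scale/= !fctE addrC (mulrC (f' s)).
  have Dq k : D (q k ^+ a k) (fun s => (a k)%:R * q k s ^+ (a k).-1 * q' k s).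
    by move=> s; have := is_deriveX (a k) (dq k s); congr (is_derive _ _ _ _).
  have := @leibniz_prod _ D D1 DM 'I_N xpredT _ _ (fun k _ => Dq k).
  move=> /(_ t); congr (is_derive _ _ _ _).
    apply/funext => s; rewrite fct_prodE; apply: eq_bigr => k _.
    by rewrite tnth_mktuple exprfctE.
  rewrite fct_sumE; apply: eq_bigr => k _; rewrite mono_dec.
  rewrite mulrfctE fct_prodE tnth_mktuple mulrAC mulrC mulr_natl.
  congr (_ * (_ * _)).
  by apply: eq_bigr => l _; rewrite tnth_mktuple exprfctE.
have d2 : is_derive t 1 (fun s => expR (h * tnth [tuple q k s | k < N] j))
   (h * q' j t * expR (h * q j t)).
  rewrite (_ : (fun s => _) = expR \o (h *: q j)); last first.
    by apply/funext => s; rewrite tnth_mktuple.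
  have := @is_derive1_comp _ expR (h *: q j) t _ _
    (is_derive_expR (h * q j t)) (is_deriveZ h (dq j t)).
  by congr (is_derive _ _ _ _); rewrite mulrC.
have := is_deriveM d1 d2; congr (is_derive _ _ _ _).
rewrite /GRing.scale/= tnth_mktuple.
under [RHS]eq_bigr do rewrite /grad_mono_exp mulrDr.
rewrite big_split/= [RHS]addrC; congr (_ + _).
- rewrite (bigD1 j)//= eqxx big1 ?addr0 => [|k /negbTE->]; last by rewrite mulr0 mul0r mulr0.
  by rewrite mulr1 /mono_exp tnth_mktuple; ring.
- rewrite mulr_sumr; apply: eq_bigr => k _.
  by rewrite /mono_exp tnth_mktuple; ring.
Qed.

(** The derivative along the rotation trades a factor [p_j] for [p_i], or [p_i] for [p_j] with a
    minus sign; acting on the exponent [h * p_j] it produces the last term. *)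
Lemma sphere_ward (a : 'I_N -> nat) (i : 'I_N) : i != j ->
  \int[sphere]_p (((a j)%:R * mono_exp (exp_inc (exp_dec a j) i) p
    - (a i)%:R * mono_exp (exp_inc (exp_dec a i) j) p)
    + h * mono_exp (exp_inc a i) p) = 0.
Proof.
move=> ij.
have gE b k : mono_exp (exp_inc b k) = fun p => tnth p k * mono_exp b p.
  by apply/funext => p; rewrite /mono_exp mono_inc mulrA.
have int b : sphere.-integrable setT (EFin \o mono_exp b).
  exact: (integrable_sphere (measurable_mono_exp b) (bounded_mono_exp b)).
have mG k : measurable_fun setT (grad_mono_exp a k).
  by apply: measurable_funD; apply: measurable_funM => //; exact: measurable_mono_exp.
have bG k : cube_bounded (grad_mono_exp a k).
  have [M1 b1] := bounded_mono_exp (exp_dec a k).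
  have [M2 b2] := bounded_mono_exp a.
  exists ((a k)%:R * M1 + `|h * (k == j)%:R| * M2) => p p1.
  apply: le_trans (ler_normD _ _) _; apply: lerD; rewrite normrM.
    by rewrite ger0_norm// ler_wpM2l// b1.
  by rewrite ler_wpM2l// b2.
have cG k : curve_continuous (grad_mono_exp a k).
  move=> q cq t; apply: cvgD; (apply: cvgM; [exact: cvg_cst|exact: curve_continuous_mono_exp]).
have intg k l : sphere.-integrable setT (EFin \o (fun p => tnth p k * grad_mono_exp a l p)).
  apply: integrable_sphere.
    by apply: measurable_funM => //; exact: measurable_tnth.
  have [M bM] := bG l; exists M => p p1.
  by rewrite normrM -[leRHS]mul1r ler_pM// bM.
have := sphere_rotation (has_grad_mono_exp a) cG (measurable_mono_exp a) mG
  (bounded_mono_exp a) bG ij.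
move=> /(congr1 fine).
rewrite -[LHS]/(\int[sphere]_p (tnth p i * grad_mono_exp a j p)).
rewrite -[RHS]/(\int[sphere]_p (tnth p j * grad_mono_exp a i p)).
move=> /eqP; rewrite -subr_eq0 => /eqP <-.
rewrite -RintegralB//.
apply: eq_Rintegral => p _.
rewrite !gE /grad_mono_exp eqxx (negbTE ij) mulr1 mulr0 mul0r addr0; ring.
Qed.

End sphere_moments.

(** * Signs of the one-spin moments, and comparison between them *)

Section moments.
Context (R : realType) (N : nat) (j : 'I_N).
Local Notation gaussN := (product_prob (normal_prob (0 : R) 1) N).
Local Notation sphere := (uniform_sphere R N).
Implicit Types (h : R) (a : 'I_N -> nat) (p : N.-tuple R).

Definition moment h a : R := \int[sphere]_p mono_exp h j a p.

Lemma integrable_mono_exp h a : sphere.-integrable setT (EFin \o mono_exp h j a).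
Proof. exact: (integrable_sphere (measurable_mono_exp h j a) (bounded_mono_exp h j a)). Qed.

Lemma mono_sflip i a p : mono a (sflip i p) = (-1) ^+ a i * mono a p.
Proof.
rewrite /mono (bigD1 i)//= [in RHS](bigD1 i)//= tnth_mktuple eqxx.
rewrite [X in X * _]exprNn -!mulrA.
by congr (_ * (_ * _)); apply: eq_bigr => k /negbTE ki; rewrite tnth_mktuple ki.
Qed.

Lemma moment_odd h a i : i != j -> odd (a i) -> moment h a = 0.
Proof.
move=> ij ai; suff : moment h a = - moment h a by lra.
rewrite {1}/moment /Rintegral.
rewrite -(integral_sflip i (measurable_mono_exp h j a) (bounded_mono_exp h j a)).
rewrite -[RHS]mulN1r -RintegralZl//; last exact: integrable_mono_exp.
congr fine; apply: eq_integral => p _; congr EFin.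
rewrite /mono_exp mono_sflip tnth_mktuple eq_sym (negbTE ij).
by rewrite -signr_odd ai expr1 mulrA.
Qed.

Lemma moment_opp h a : moment (- h) a = (-1) ^+ a j * moment h a.
Proof.
rewrite -RintegralZl//; last exact: integrable_mono_exp.
rewrite /moment /Rintegral.
rewrite -(integral_sflip j (measurable_mono_exp (- h) j a) (bounded_mono_exp (- h) j a)).
congr fine; apply: eq_integral => p _; congr EFin.
by rewrite /mono_exp mono_sflip tnth_mktuple eqxx mulrNN mulrA.
Qed.

(* Averaging over the reflection of the component [j] replaces the exponential
   by a hyperbolic cosine or sine, according to the parity of [a j]. *)
Let symm h a p := mono a p * (expR (h * tnth p j) + (-1) ^+ a j * expR (- h * tnth p j)).

Let symmE h a : \int[sphere]_p symm h a p = moment h a *+ 2.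
Proof.
have mo : moment h a = (-1) ^+ a j * moment (- h) a.
  by rewrite moment_opp mulrA -signr_odd -expr2 sqrr_sign mul1r.
rewrite mulr2n {2}mo -RintegralZl//; last exact: integrable_mono_exp.
rewrite -RintegralD//; first 1 last.
- exact: integrable_mono_exp.
- exact: (integrableZl measurableT _ (integrable_mono_exp _ _)).
by apply: eq_Rintegral => p _; rewrite /symm mulrDr mulrCA.
Qed.

Let symm_ge0 h a p : 0 < h -> (forall i, i != j -> ~~ odd (a i)) -> 0 <= symm h a p.
Proof.
move=> h0 aev; rewrite /symm /mono (bigD1 j)//= mulrAC.
apply: mulr_ge0; last first.
  by apply: prodr_ge0 => k kj; rewrite exprn_even_ge0 ?aev.
rewrite -signr_odd; have [aj|aj] := boolP (odd (a j)); last first.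
  by rewrite mulr_ge0 ?exprn_even_ge0// mul1r addr_ge0 ?expR_ge0.
rewrite expr1 mulN1r -(odd_double_half (a j)) aj exprD expr1.
rewrite mulrAC mulr_ge0 ?exprn_even_ge0 ?odd_double//.
have [pj|pj] := leP (tnth p j) 0.
- by rewrite mulr_le0// subr_le0 ler_expR mulNr; nra.
- by rewrite mulr_ge0 ?(ltW pj)// subr_ge0 ler_expR mulNr; nra.
Qed.

Let symm_neq0 h a p : 0 < h -> (forall k, tnth p k != 0) -> symm h a p != 0.
Proof.
move=> h0 p0; rewrite mulf_neq0//.
  by apply/prodf_neq0 => k _; rewrite expf_neq0.
rewrite -signr_odd; case: (odd (a j)); last first.
  by rewrite mul1r gt_eqF// addr_gt0// expR_gt0.
rewrite expr1 mulN1r subr_eq0 (inj_eq (@expR_inj R)) mulNr -subr_eq0 opprK -mulr2n.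
by rewrite mulrn_eq0 mulf_neq0// gt_eqF.
Qed.

Let gauss_neq0 (k : 'I_N) : {ae gaussN, forall v, tnth v k != 0}.
Proof.
pose A := [set v : N.-tuple (measurableTypeR R) | tnth v k = 0].
have mA : measurable A.
  have := @measurable_tnth _ (measurableTypeR R) N k measurableT [set 0].
  by rewrite setTI; apply; exact: measurable_set1.
exists A; split => //; last by move=> v /= /negP; rewrite negbK => /eqP.
rewrite -[in LHS](setIT A) -(integral_indic gaussN measurableT)//.
rewrite (ge0_integral_tset _ k).
- apply: integral0_eq => v _.
  transitivity (\int[normal_prob (0 : R) 1]_t
      (\1_([set 0] : set (measurableTypeR R)) t)%:E)%E.
    apply: eq_integral => t _; congr EFin; rewrite !indicE; congr ((_ : bool)%:R).
    by apply/idP/idP; rewrite !inE /A/= tnth_mktuple eqxx.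
  rewrite integral_indic// setIT.
  have /null_content_dominatesP := normal_prob_dominates (0 : R) 1.
  by apply => //; exact: lebesgue_measure_set1.
- by apply/measurable_EFinP; exact: measurable_indic.
- by move=> v; rewrite lee_fin.
Qed.

(** The symmetrised integrand is nonnegative, and nonzero off the coordinate hyperplanes. These are
    Gaussian-null, so a zero integral would make the whole space null. Strictness matters because
    these moments become denominators in [moment_inc]. *)
Lemma moment_gt0 h a : 0 < h -> (forall i, i != j -> ~~ odd (a i)) -> 0 < moment h a.
Proof.
move=> h0 aev.
have ms : measurable_fun setT (symm h a).
  apply: measurable_funM; first exact: measurable_mono.
  have me c : measurable_fun setT (fun p : N.-tuple R => expR (c * tnth p j)).
    apply: measurableT_comp => //; apply: measurable_funM => //.
    exact: measurable_tnth.
  by apply: measurable_funD => //; apply: measurable_funM.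
have bs : cube_bounded (symm h a).
  have [M1 b1] := bounded_mono_exp h j a; have [M2 b2] := bounded_mono_exp (- h) j a.
  exists (M1 + M2) => p p1; rewrite /symm mulrDr.
  rewrite (le_trans (ler_normD _ _))// lerD ?b1// mulrCA normrM normrX normrN1.
  by rewrite expr1n mul1r b2.
have neq0 : {ae gaussN, forall v, forall k, tnth v k != 0}.
  by apply: filter_forall => k; exact: gauss_neq0.
rewrite -(pmulrn_lgt0 _ (n := 2))// -symmE lt_def andbC Rintegral_ge0 /=; last first.
  by move=> p _; exact: symm_ge0.
apply/eqP => I0.
have : (\int[gaussN]_v `|(symm h a (direction v))%:E| = 0)%E.
  under eq_integral do rewrite gee0_abs ?lee_fn ?lee_fin ?symm_ge0//.
  rewrite -integral_sphere// -[LHS]fineK; first by rewrite [X in X%:E]I0.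
  by apply: (integrable_fin_num measurableT); exact: integrable_sphere.
have msd : measurable_fun setT (fun v => (symm h a (direction v))%:E).
  by apply/measurable_EFinP; apply: (measurableT_comp ms); exact: measurable_direction.
move/(ae_eq_integral_abs _ measurableT msd) => s0.
have [B [mB B0 sB]] : {ae gaussN, forall v : N.-tuple (measurableTypeR R), False}.
  have FF := @ae_filter_ringOfSetsType _ _ _ gaussN.
  apply: (@filterS2 _ _ FF _ _ _ _ neq0 s0) => v v0 /(_ I)[].
  apply/eqP; apply: symm_neq0 => // k.
  rewrite tnth_direction mulf_neq0// invr_eq0 gt_eqF// sqrtr_gt0.
  by apply: lt_le_trans (dot_ge v k); rewrite exprn_even_gt0//=; exact: v0.
have := @probability_setT _ _ _ gaussN.
have -> : setT = B by apply/seteqP; split => // v _; exact: sB.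
by move=> B1; have := oner_neq0 R; rewrite -eqe -B1 B0 eqxx.
Qed.

Lemma moment_ge0 h a : 0 < h -> 0 <= moment h a.
Proof.
move=> h0.
have [/existsP[i /andP[ij ai]]|/existsPn aev] := boolP [exists i, (i != j) && odd (a i)].
  by rewrite (moment_odd _ ij ai).
by apply/ltW/moment_gt0 => // i ij; have := aev i; rewrite ij.
Qed.

(** Only finitely many exponents are bounded by [K], so the sum of all the ratios bounds each of
    them. If the moment on the right is 0 because some component other than [j] has an odd exponent,
    raising the exponent of [j] leaves that parity alone and the left-hand side is 0 too. *)
Lemma moment_inc h (K : nat) : 0 < h ->
  exists2 C : R, 0 < C & forall a, (forall i, (a i <= K)%N) ->
    moment h (exp_inc a j) <= C * moment h a.
Proof.
move=> h0.
pose e (a : {ffun 'I_N -> 'I_K.+1}) : 'I_N -> nat := fun i => a i.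
pose c b := moment h (exp_inc (e b) j) / moment h (e b).
have c0 b : 0 <= c b by rewrite divr_ge0// moment_ge0.
exists (1 + \sum_b c b); first by rewrite ltr_pwDl// sumr_ge0.
move=> a aK.
have [/existsP[i /andP[ij ai]]|/existsPn aev] := boolP [exists i, (i != j) && odd (a i)].
  rewrite (moment_odd h ij ai) mulr0 (moment_odd h ij)//.
  by rewrite /exp_inc (negbTE ij) addn0.
have m0 : 0 < moment h a.
  by apply: moment_gt0 => // i ij; have := aev i; rewrite ij.
pose b : {ffun 'I_N -> 'I_K.+1} := [ffun i => inord (a i)].
have bE : e b = a.
  by apply/funext => i; rewrite /e ffunE inordK// ltnS.
rewrite -ler_pdivrMr//.
have -> : moment h (exp_inc a j) / moment h a = c b by rewrite /c bE.
by rewrite (bigD1 b)//= addrCA lerDl addr_ge0// sumr_ge0.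
Qed.

End moments.

(** * Polynomials in the spins *)

Section spin_polynomials.
Context (R : realType) (V : finType) (N : nat) (j : 'I_N).
Local Notation conf := (config R V N).
Implicit Types (h : R) (al be : V -> 'I_N -> nat) (F G : conf -> R) (v w : V).

Definition cmono al : conf -> R := fun phi => \prod_v mono (al v) (spin v phi).

Definition field_weight h : conf -> R :=
  fun phi => expR (h * \sum_v tnth (spin v phi) j).

Definition field_integrable h F :=
  (config_prob R V N).-integrable setT (EFin \o (field_weight h * F)).

Definition field_mean h F : R :=
  \int[config_prob R V N]_phi (field_weight h phi * F phi).

Let cmono_weightE h al phi : field_weight h phi * cmono al phi =
  \prod_(l < #|V|) mono_exp h j (al (enum_val l)) (tnth phi l).
Proof.
rewrite /field_weight mulr_sumr expR_sum -big_split/=.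
rewrite [RHS](reindex (@enum_rank V)); last exact/onW_bij/enum_rank_bij.
by apply: eq_bigr => v _; rewrite enum_rankK mulrC.
Qed.

Lemma field_integrable_cmono h al : field_integrable h (cmono al).
Proof.
have := integrable_product_prob
  (fun l : 'I_#|V| => integrable_mono_exp j h (al (enum_val l))).
by congr (_.-integrable _ _); apply/funext => phi /=; rewrite -cmono_weightE.
Qed.

Lemma field_mean_cmono h al : field_mean h (cmono al) = \prod_v moment j h (al v).
Proof.
rewrite [RHS](reindex (@enum_val V V)); last exact/onW_bij/enum_val_bij.
rewrite -(Rintegral_product_prob
  (fun l : 'I_#|V| => integrable_mono_exp j h (al (enum_val l)))).
by apply: eq_Rintegral => phi _; rewrite cmono_weightE.
Qed.

Lemma field_integrable0 h : field_integrable h 0.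
Proof.
rewrite /field_integrable mulr0; exact: (finite_measure_integrable_cst _ 0 measurableT).
Qed.

Lemma field_integrableD h F G :
  field_integrable h F -> field_integrable h G -> field_integrable h (F + G).
Proof.
move=> iF iG; have := integrableD measurableT iF iG.
by congr (_.-integrable _ _); apply/funext => phi /=; rewrite !fctE mulrDr.
Qed.

Lemma field_integrableZ h c F : field_integrable h F -> field_integrable h (c *: F).
Proof.
move=> iF; have := integrableZl measurableT c iF.
by congr (_.-integrable _ _); apply/funext => phi /=; rewrite !fctE mulrCA.
Qed.

Lemma field_meanD h F G : field_integrable h F -> field_integrable h G ->
  field_mean h (F + G) = field_mean h F + field_mean h G.
Proof.
move=> iF iG; rewrite -RintegralD//.
by apply: eq_Rintegral => phi _; rewrite mulrDr.
Qed.

Lemma field_meanZ h c F : field_integrable h F ->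
  field_mean h (c *: F) = c * field_mean h F.
Proof.
move=> iF; rewrite -RintegralZl//.
by apply: eq_Rintegral => phi _; rewrite /= fctE mulrCA.
Qed.

Lemma field_mean0 h : field_mean h 0 = 0.
Proof. by rewrite -(scaler0 _ 0) field_meanZ ?mul0r//; exact: field_integrable0. Qed.

Lemma field_integrable_sum h (I : Type) (s : seq I) (P : pred I) (F : I -> conf -> R) :
  (forall l, P l -> field_integrable h (F l)) ->
  field_integrable h (\sum_(l <- s | P l) F l).
Proof.
move=> iF; elim/big_ind: _ => //; [exact: field_integrable0|exact: field_integrableD].
Qed.

Lemma field_mean_sum h (I : Type) (s : seq I) (P : pred I) (F : I -> conf -> R) :
  (forall l, P l -> field_integrable h (F l)) ->
  field_mean h (\sum_(l <- s | P l) F l) = \sum_(l <- s | P l) field_mean h (F l).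
Proof.
move=> iF; elim: s => [|l s IH]; first by rewrite !big_nil field_mean0.
rewrite !big_cons; case: ifPn => // Pl.
by rewrite field_meanD ?IH//; [exact: iF|exact: field_integrable_sum].
Qed.

Lemma cmonoD al be : cmono (fun v k => al v k + be v k)%N = cmono al * cmono be.
Proof.
apply/funext => phi; rewrite fctE /cmono -big_split/=.
by apply: eq_bigr => v _; rewrite monoD.
Qed.

Definition set_exp al v (b : 'I_N -> nat) : V -> 'I_N -> nat :=
  fun w => if w == v then b else al w.

Lemma cmono_set al v b phi : cmono (set_exp al v b) phi =
  mono b (spin v phi) * \prod_(w | w != v) mono (al w) (spin w phi).
Proof.
rewrite /cmono (bigD1 v)//= /set_exp eqxx; congr (_ * _).
by apply: eq_bigr => w /negbTE ->.
Qed.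

Lemma field_mean_set h al v b : field_mean h (cmono (set_exp al v b)) =
  moment j h b * \prod_(w | w != v) moment j h (al w).
Proof.
rewrite field_mean_cmono (bigD1 v)//= /set_exp eqxx; congr (_ * _).
by apply: eq_bigr => w /negbTE ->.
Qed.

Lemma set_exp_id al v : set_exp al v (al v) = al.
Proof. by apply/funext => w; rewrite /set_exp; case: eqP => [->|]. Qed.

Definition spin_coord v (k : 'I_N) : conf -> R := fun phi => tnth (spin v phi) k.

Lemma spin_coordE v k :
  spin_coord v k = cmono (set_exp (fun _ _ => 0%N) v (exp_inc (fun=> 0%N) k)).
Proof.
apply/funext => phi; rewrite cmono_set mono_inc mono0 mulr1 big1 ?mulr1// => w _.
exact: mono0.
Qed.

Lemma spin_coord_mul v k al :
  spin_coord v k * cmono al = cmono (set_exp al v (exp_inc (al v) k)).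
Proof.
apply/funext => phi; rewrite cmono_set mono_inc fctE -mulrA; congr (_ * _).
by rewrite /cmono (bigD1 v).
Qed.

(* Polynomials with nonnegative coefficients, of degree at most [D v] in the spin
   at [v], and whose total degree in the field component has the parity [b]. *)
Inductive cone (D : V -> nat) (b : bool) : (conf -> R) -> Prop :=
| cone_mono al of (forall v, \sum_k al v k <= D v)%N &
    odd (\sum_v al v j) = b : cone D b (cmono al)
| cone0 : cone D b 0
| coneD F G of cone D b F & cone D b G : cone D b (F + G)
| coneZ c F of 0 <= c & cone D b F : cone D b (c *: F).

Lemma cone_integrable D b h F : cone D b F -> field_integrable h F.
Proof.
elim=> [al _ _||F1 G1 _ + _|c F1 _ _].
- exact: field_integrable_cmono.
- exact: field_integrable0.
- exact: field_integrableD.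
- exact: field_integrableZ.
Qed.

Lemma field_mean_ge0 D b h F : 0 < h -> cone D b F -> 0 <= field_mean h F.
Proof.
move=> h0; elim=> [al _ _||F1 G1 cF F0 cG G0|c F1 c0 cF F0].
- by rewrite field_mean_cmono prodr_ge0// => v _; exact: moment_ge0.
- by rewrite field_mean0.
- by rewrite (field_meanD (cone_integrable h cF) (cone_integrable h cG)) addr_ge0.
- by rewrite field_meanZ ?mulr_ge0//; exact: cone_integrable cF.
Qed.

Lemma field_mean_opp D b h F : cone D b F ->
  field_mean (- h) F = (-1) ^+ b * field_mean h F.
Proof.
elim=> [al _ <-||F1 G1 cF F0 cG G0|c F1 c0 cF F0].
- rewrite !field_mean_cmono signr_odd -prodrXr -big_split/=.
  by apply: eq_bigr => v _; rewrite moment_opp.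
- by rewrite !field_mean0 mulr0.
- by rewrite !(field_meanD (cone_integrable _ cF) (cone_integrable _ cG)) F0 G0 mulrDr.
- by rewrite !field_meanZ ?F0 1?mulrCA//; exact: cone_integrable cF.
Qed.

Lemma cone_le D D' b F : (forall v, D v <= D' v)%N -> cone D b F -> cone D' b F.
Proof.
move=> DD'; elim=> [al aD ab||F1 G1 _ + _|c F1 c0 _].
- by apply: cone_mono => // v; exact: leq_trans (DD' v).
- exact: cone0.
- exact: coneD.
- exact: coneZ.
Qed.

Lemma mulr_scale c F G : F * (c *: G) = c *: (F * G).
Proof. by apply/funext => phi; rewrite !fctE /GRing.scale/= mulrCA. Qed.

Lemma scale_mulr c F G : (c *: F) * G = c *: (F * G).
Proof. by rewrite mulrC mulr_scale mulrC. Qed.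

Lemma coneM D D' b b' F G : cone D b F -> cone D' b' G ->
  cone (fun v => D v + D' v)%N (b (+) b') (F * G).
Proof.
move=> cF cG; elim: cF => [al aD ab||F1 G1 _ IF _ IG|c F1 c0 _ IF].
- elim: cG => [be bD bb||F1 G1 _ IF _ IG|c F1 c0 _ IF].
  + rewrite -cmonoD; apply: cone_mono => [v|].
      by rewrite big_split leq_add.
    by rewrite big_split oddD ab bb.
  + by rewrite mulr0; exact: cone0.
  + by rewrite mulrDr; exact: coneD.
  + by rewrite mulr_scale; exact: coneZ.
- by rewrite mul0r; exact: cone0.
- by rewrite mulrDl; exact: coneD.
- by rewrite scale_mulr; exact: coneZ.
Qed.

Lemma cone1 D : cone D false 1.
Proof.
have -> : 1 = cmono (fun _ _ => 0%N).
  by apply/funext => phi; rewrite /cmono big1// => v _; exact: mono0.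
by apply: cone_mono => [v|]; rewrite big1.
Qed.

Lemma cone_spin_coord v k : cone (fun w => w == v) (k == j) (spin_coord v k).
Proof.
rewrite spin_coordE; apply: cone_mono => [w|].
  rewrite /set_exp; case: eqP => _; last by rewrite big1.
  rewrite /exp_inc; under eq_bigr do rewrite add0n.
  by rewrite -big_mkcond/= sum1_card card1.
rewrite (bigD1 v)//= /set_exp eqxx /exp_inc add0n big1 ?addn0 1?eq_sym.
  by case: (k == j).
by move=> w /negbTE ->.
Qed.

Lemma cone_prod (I : Type) (s : seq I) (P : pred I) (D : I -> V -> nat)
    (F : I -> conf -> R) :
  (forall l, P l -> cone (D l) false (F l)) ->
  cone (fun v => \sum_(l <- s | P l) D l v)%N false (\prod_(l <- s | P l) F l).
Proof.
move=> cF; elim: s => [|l s IH].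
  by rewrite big_nil; exact: cone1.
rewrite big_cons; under [X in cone X]eq_fun do rewrite big_cons.
case: ifPn => // Pl.
exact: (@coneM (D l) _ false false _ _ (cF _ Pl) IH).
Qed.

Lemma cone_exp D F l : cone D false F -> cone (fun v => l * D v)%N false (F ^+ l).
Proof.
move=> cF; elim: l => [|l IH].
  by rewrite expr0; exact: cone1.
by rewrite exprS; under [X in cone X]eq_fun do rewrite mulSn; exact: (@coneM D _ false false).
Qed.

Lemma cone_sum (I : Type) (s : seq I) (P : pred I) D b (F : I -> conf -> R) :
  (forall l, P l -> cone D b (F l)) -> cone D b (\sum_(l <- s | P l) F l).
Proof.
move=> cF; elim/big_ind: _ => //; [exact: cone0|by move=> *; exact: coneD].
Qed.

(** On a monomial the mean factorises over the sites, and the extra factor affects only the moment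
    at [v]. The same [C] serves all monomials, so the inequality passes to combinations with
    nonnegative coefficients. *)
Lemma field_mean_coord_le h (K : nat) (C : R) D b F v : 0 < h ->
  (forall a, (forall k, (a k <= K)%N) -> moment j h (exp_inc a j) <= C * moment j h a) ->
  (D v <= K)%N -> cone D b F ->
  field_mean h (spin_coord v j * F) <= C * field_mean h F.
Proof.
move=> h0 CP DK.
have ic G : cone D b G -> field_integrable h (spin_coord v j * G).
  by move=> cG; apply: cone_integrable; exact: coneM (cone_spin_coord v j) cG.
elim=> [al aD _||F1 G1 cF IF cG IG|c F1 c0 cF IF].
- rewrite spin_coord_mul field_mean_set -[in leRHS](set_exp_id al v) field_mean_set.
  rewrite mulrA ler_wpM2r ?prodr_ge0// => [w _|]; first exact: moment_ge0.
  apply: CP => k; apply: leq_trans DK; apply: leq_trans (aD v).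
  by rewrite (bigD1 k)//= leq_addr.
- by rewrite mulr0 field_mean0 mulr0.
- rewrite mulrDr (field_meanD (ic _ cF) (ic _ cG)).
  by rewrite (field_meanD (cone_integrable h cF) (cone_integrable h cG)) mulrDr lerD.
- rewrite mulr_scale !field_meanZ; [|exact: cone_integrable cF|exact: ic].
  by rewrite mulrCA ler_wpM2l.
Qed.

End spin_polynomials.

(** * The Ward identity *)

Section single_site_rotation.
Context (R : realType) (N : nat).
Implicit Types (a b : 'I_N -> nat) (p : N.-tuple R) (i j k : 'I_N).

(** The product rule for powers of [x], valid also at exponent 0, where the multiplicity 0 cancels
    the meaningless power. *)
Lemma natmul_exp_predD (x : R) m n :
  x ^+ (m + n).-1 *+ (m + n) = (x ^+ m.-1 *+ m) * x ^+ n + x ^+ m * (x ^+ n.-1 *+ n).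
Proof.
case: m n => [|m] [|n].
- by rewrite !mulr0n mul0r mulr0 addr0.
- by rewrite mulr0n mul0r add0r expr0 mul1r.
- by rewrite addn0 mulr0n mulr0 addr0 expr0 mulr1.
rewrite /=.
by rewrite mulrnAl mulrnAr -!exprD [X in _ + x ^+ X *+ _]addSnnS -mulrnDr.
Qed.

Lemma mono_decD a b k p :
  (a k + b k)%:R * mono (exp_dec (fun l => a l + b l)%N k) p =
  (a k)%:R * mono (exp_dec a k) p * mono b p +
  mono a p * ((b k)%:R * mono (exp_dec b k) p).
Proof.
rewrite (mono_dec (fun l => a l + b l)%N k p) !mono_dec natmul_exp_predD.
have E c : mono c p = tnth p k ^+ c k * \prod_(l | l != k) tnth p l ^+ c l.
  by rewrite /mono (bigD1 k).
rewrite !E (eq_bigr (fun l => tnth p l ^+ a l * tnth p l ^+ b l)); last first.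
  by move=> l _; rewrite exprD.
rewrite big_split/=; ring.
Qed.

(** The vector field [x_i d/dx_j - x_j d/dx_i], which generates the rotations of the plane, applied
    to a monomial. *)
Definition rot_mono i j a p : R :=
  (a j)%:R * mono (exp_inc (exp_dec a j) i) p -
  (a i)%:R * mono (exp_inc (exp_dec a i) j) p.

Lemma rot_monoD i j a b p : rot_mono i j (fun l => a l + b l)%N p =
  rot_mono i j a p * mono b p + mono a p * rot_mono i j b p.
Proof.
rewrite /rot_mono !mono_inc.
have E k l : (a k + b k)%:R * (tnth p l * mono (exp_dec (fun l => a l + b l)%N k) p)
  = tnth p l * ((a k)%:R * mono (exp_dec a k) p * mono b p +
  mono a p * ((b k)%:R * mono (exp_dec b k) p)).
  by rewrite mulrCA mono_decD.
rewrite !E; ring.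
Qed.

End single_site_rotation.

Lemma moment_ward (R : realType) (N : nat) (i j : 'I_N) (h : R) (b : 'I_N -> nat) :
  i != j -> (b j)%:R * moment j h (exp_inc (exp_dec b j) i) -
    (b i)%:R * moment j h (exp_inc (exp_dec b i) j) +
    h * moment j h (exp_inc b i) = 0.
Proof.
move=> ij; have := sphere_ward h b ij.
have im := integrable_mono_exp j h.
have imZ c d : (uniform_sphere R N).-integrable setT
    (EFin \o (fun p => c * mono_exp h j d p)) by exact: (integrableZl measurableT c (im d)).
rewrite RintegralD//; last first.
  exact: (integrableB measurableT (imZ _ _) (imZ _ _)).
by rewrite RintegralB// !RintegralZl.
Qed.

Section rotation.
Context (R : realType) (V : finType) (N : nat) (i j : 'I_N).
Hypothesis ij : i != j.
Local Notation conf := (config R V N).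
Implicit Types (h : R) (al be : V -> 'I_N -> nat) (F G : conf -> R) (v w : V).

Section derivation.
Variable a : V -> R.

Definition rot_cmono al : conf -> R := \sum_v a v *:
  ((al v j)%:R *: cmono (set_exp al v (exp_inc (exp_dec (al v) j) i)) -
   (al v i)%:R *: cmono (set_exp al v (exp_inc (exp_dec (al v) i) j))).

Lemma rot_cmonoE al phi : rot_cmono al phi = \sum_v a v *
  (rot_mono i j (al v) (spin v phi) * \prod_(w | w != v) mono (al w) (spin w phi)).
Proof.
rewrite /rot_cmono fct_sumE; apply: eq_bigr => v _.
by rewrite !fctE/= !cmono_set /GRing.scale/= /rot_mono mulrBl !mulrA.
Qed.

(* [is_rot F G] : [G] is the derivative of the polynomial [F] when the spin at [v]
   rotates in the plane of the components [i] and [j] at speed [a v]. *)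
Inductive is_rot : (conf -> R) -> (conf -> R) -> Prop :=
| rot_base al : is_rot (cmono al) (rot_cmono al)
| rot0 : is_rot 0 0
| rotD F F' G G' of is_rot F F' & is_rot G G' : is_rot (F + G) (F' + G')
| rotZ c F F' of is_rot F F' : is_rot (c *: F) (c *: F').

Lemma rot_cmonoD al be : rot_cmono (fun v k => al v k + be v k)%N =
  rot_cmono al * cmono be + cmono al * rot_cmono be.
Proof.
apply/funext => phi; rewrite !fctE !rot_cmonoE mulr_suml mulr_sumr -big_split/=.
apply: eq_bigr => v _; rewrite rot_monoD.
have E c : cmono c phi =
    mono (c v) (spin v phi) * \prod_(w | w != v) mono (c w) (spin w phi).
  by rewrite -cmono_set set_exp_id.
have -> : \prod_(w | w != v) mono (fun k => al w k + be w k)%N (spin w phi) =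
    (\prod_(w | w != v) mono (al w) (spin w phi)) *
    \prod_(w | w != v) mono (be w) (spin w phi).
  by rewrite -big_split/=; apply: eq_bigr => w _; rewrite monoD.
rewrite !E; ring.
Qed.

Lemma rotM F F' G G' : is_rot F F' -> is_rot G G' -> is_rot (F * G) (F' * G + F * G').
Proof.
move=> rF rG; elim: rF => [al||F1 F1' F2 F2' _ I1 _ I2|c F1 F1' _ I1].
- elim: rG => [be||F1 F1' F2 F2' _ I1 _ I2|c F1 F1' _ I1].
  + by rewrite -cmonoD -rot_cmonoD; exact: rot_base.
  + by rewrite !mulr0 addr0; exact: rot0.
  + by rewrite !mulrDr addrACA; exact: rotD.
  + by rewrite !mulr_scale -scalerDr; exact: rotZ.
- by rewrite !mul0r addr0; exact: rot0.
- by rewrite !mulrDl addrACA; exact: rotD.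
- by rewrite !scale_mulr -scalerDr; exact: rotZ.
Qed.

Lemma rot1 : is_rot 1 0.
Proof.
have -> : 1 = cmono (fun _ _ => 0%N) :> (conf -> R).
  by apply/funext => phi; rewrite /cmono big1// => v _; exact: mono0.
rewrite (_ : 0 = rot_cmono (fun _ _ => 0%N)); first exact: rot_base.
apply/funext => phi; rewrite rot_cmonoE big1// => v _.
by rewrite /rot_mono !mul0r subrr mul0r mulr0.
Qed.

Lemma rot_coord v k : is_rot (spin_coord v k)
  (a v *: ((k == j)%:R *: spin_coord v i - (k == i)%:R *: spin_coord v j)).
Proof.
rewrite [X in is_rot X _]spin_coordE (_ : a v *: _ =
  rot_cmono (set_exp (fun _ _ => 0%N) v (exp_inc (fun=> 0%N) k)));
  first exact: rot_base.
apply/funext => phi; rewrite rot_cmonoE (bigD1 v)//= [X in _ = _ + X]big1 ?addr0; last first.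
  by move=> w wv; rewrite /rot_mono /set_exp (negbTE wv) !mul0r subrr mul0r mulr0.
rewrite !fctE/= /GRing.scale/=; congr (_ * _).
rewrite big1 ?mulr1; last by move=> w wv; rewrite /set_exp (negbTE wv) mono0.
rewrite /rot_mono /set_exp eqxx !mono_inc /spin_coord.
have E l : (exp_inc (fun=> 0%N) k l)%:R * mono (exp_dec (exp_inc (fun=> 0%N) k) l) (spin v phi)
  = (k == l)%:R.
  rewrite /exp_inc add0n eq_sym; have [->|_] := eqVneq k l; last by rewrite mul0r.
  rewrite mul1r /exp_dec (_ : (fun _ => _) = fun=> 0%N) ?mono0//.
  by apply/funext => m; rewrite add0n subnn.
by congr (_ - _); rewrite [RHS]mulrCA E mulrC.
Qed.

Lemma rot_sum (I : Type) (s : seq I) (P : pred I) (F F' : I -> conf -> R) :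
  (forall l, P l -> is_rot (F l) (F' l)) ->
  is_rot (\sum_(l <- s | P l) F l) (\sum_(l <- s | P l) F' l).
Proof.
move=> rF; elim/big_ind2: _ => //; [exact: rot0|by move=> *; exact: rotD].
Qed.

Lemma rot_exp F F' l : is_rot F F' -> is_rot (F ^+ l) ((F ^+ l.-1 *+ l) * F').
Proof.
move=> rF; elim: l => [|l IH]; first by rewrite expr0 mulr0n mul0r; exact: rot1.
have := rotM rF IH; rewrite -exprS; congr is_rot.
case: l {IH} => [|l]; first by rewrite !expr0 mulr0n mul0r mulr0 addr0 mulr1n mulr1 mul1r.
by rewrite /= mulrA mulrnAr -exprS [F' * _]mulrC -mulrDl -mulrS.
Qed.

(** On a monomial the product measure decouples the sites, and each site contributes [moment_ward];
    the rest is linearity. Integrability is proved along with the identity because additivity of the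
    mean depends on it. *)
Lemma ward h F G : is_rot F G ->
  [/\ field_integrable j h G, forall v, field_integrable j h (spin_coord v i * F) &
   field_mean j h G + h * \sum_v a v * field_mean j h (spin_coord v i * F) = 0].
Proof.
elim=> [al||F1 G1 F2 G2 _ [iG1 iF1 W1] _ [iG2 iF2 W2]|c F1 G1 _ [iG1 iF1 W1]].
- have iv v k : field_integrable j h ((al v k)%:R *: cmono (set_exp al v
       (exp_inc (exp_dec (al v) k) (if k == j then i else j)))).
    by apply: field_integrableZ; exact: field_integrable_cmono.
  have iB v : field_integrable j h
     ((al v j)%:R *: cmono (set_exp al v (exp_inc (exp_dec (al v) j) i)) -
      (al v i)%:R *: cmono (set_exp al v (exp_inc (exp_dec (al v) i) j))).
    have := iv v j; have := iv v i; rewrite eqxx (negbTE ij) => i1 i2.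
    by apply: field_integrableD => //; rewrite -scaleN1r; exact: field_integrableZ.
  split.
  + by apply: field_integrable_sum => v _; exact: field_integrableZ.
  + by move=> v; rewrite spin_coord_mul; exact: field_integrable_cmono.
  + rewrite field_mean_sum => [|v _]; last exact: field_integrableZ.
    rewrite mulr_sumr -big_split/= big1// => v _.
    rewrite field_meanZ// mulrCA -mulrDr.
    have := iv v j; have := iv v i; rewrite eqxx (negbTE ij) => i1 i2.
    rewrite -scaleN1r field_meanD//; last exact: field_integrableZ.
    rewrite !field_meanZ//; try exact: field_integrable_cmono.
    rewrite spin_coord_mul !field_mean_set !mulrA -!mulrDl.
    by rewrite mulN1r mulNr moment_ward// mul0r mulr0.
- split.
  + exact: field_integrable0.
  + by move=> v; rewrite mulr0; exact: field_integrable0.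
  + rewrite field_mean0 add0r big1 ?mulr0// => v _.
    by rewrite mulr0 field_mean0 mulr0.
- split.
  + exact: field_integrableD.
  + by move=> v; rewrite mulrDr; exact: field_integrableD.
  + rewrite field_meanD//.
    transitivity
     ((field_mean j h G1 + h * \sum_v a v * field_mean j h (spin_coord v i * F1)) +
      (field_mean j h G2 + h * \sum_v a v * field_mean j h (spin_coord v i * F2))).
      rewrite addrACA -mulrDr -big_split/=; congr (_ + _ * _); apply: eq_bigr => v _.
      by rewrite mulrDr field_meanD// mulrDr.
    by rewrite W1 W2 addr0.
- split.
  + exact: field_integrableZ.
  + by move=> v; rewrite mulr_scale; exact: field_integrableZ.
  + rewrite field_meanZ//.
    transitivity
      (c * (field_mean j h G1 + h * \sum_v a v * field_mean j h (spin_coord v i * F1))).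
      rewrite mulrDr; congr (_ + _); rewrite mulrCA; congr (_ * _).
      rewrite mulr_sumr; apply: eq_bigr => v _.
      by rewrite mulr_scale field_meanZ// mulrCA.
    by rewrite W1 mulr0.
Qed.

End derivation.

Definition spin_dot u v : conf -> R := \sum_k spin_coord u k * spin_coord v k.

Definition current u v : conf -> R :=
  spin_coord u i * spin_coord v j - spin_coord u j * spin_coord v i.

Definition edge_weight (beta : R) (m : nat) u v : conf -> R :=
  \sum_(l < m) (beta ^+ l / l`!%:R) *: spin_dot u v ^+ l.

(** Turning both spins at the same speed preserves their inner product, so only the difference of
    speeds survives. This is why slowly varying speeds give a small edge contribution. *)
Lemma rot_spin_dot a u v : is_rot a (spin_dot u v) ((a u - a v) *: current u v).
Proof.
have := @rot_sum a _ (index_enum 'I_N) xpredT _ _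
  (fun k _ => rotM (rot_coord a u k) (rot_coord a v k)).
congr is_rot; apply/funext => phi.
rewrite fct_sumE !fctE/= /GRing.scale/=.
rewrite (bigD1 j)//= (bigD1 i)//= big1 ?addr0 => [|k /andP[/negbTE kj /negbTE ki]].
  rewrite !fctE /GRing.scale/= !eqxx (negbTE ij) eq_sym (negbTE ij)/=.
  rewrite /current !fctE /GRing.scale/=; ring.
by rewrite kj ki !fctE /GRing.scale/= /GRing.scale/=; ring.
Qed.

(** The derivative of a truncated exponential is the truncation with one term fewer: [m.+1] terms
    become [m]. *)
Lemma rot_edge_weight a beta m u v : is_rot a (edge_weight beta m.+1 u v)
  ((a u - a v) *: (beta *: (current u v * edge_weight beta m u v))).
Proof.
have := @rot_sum a _ (index_enum 'I_m.+1) xpredT _ _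
  (fun l _ => rotZ (beta ^+ l / l`!%:R) (rot_exp l (rot_spin_dot a u v))).
congr is_rot; rewrite big_ord_recl/= mulr0n mul0r scaler0 add0r.
apply/funext => phi; rewrite fct_sumE !fctE/= /edge_weight fct_sumE.
rewrite /GRing.scale/= !mulr_sumr; apply: eq_bigr => l _.
have -> : bump 0 l = l.+1 by [].
rewrite add0n !fctE natmulfctE -mulr_natl /GRing.scale/= factS natrM exprS.
have f0 : l`!%:R != 0 :> R by rewrite pnatr_eq0 -lt0n fact_gt0.
have l0 : l.+1%:R != 0 :> R by rewrite pnatr_eq0.
field; exact/andP.
Qed.

End rotation.

(** * Weighted sums of correlations *)

Section decay.
Context (R : realType) (V : finType) (N : nat) (i j : 'I_N).
Hypothesis ij : i != j.
Variables (P : pred (V * V)) (k : nat) (beta : R).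
Hypothesis beta0 : 0 <= beta.
Local Notation conf := (config R V N).
Local Notation S := (@spin_coord R V N).
Local Notation edge m p := (@edge_weight R V N beta m p.1 p.2).

Definition incident (w : V) (p : V * V) : nat := (w == p.1) + (w == p.2).

Lemma cone_spin_dot (u v : V) :
  cone j (incident^~ (u, v)) false (@spin_dot R V N u v).
Proof.
apply: cone_sum => l _; have := coneM (cone_spin_coord R j u l) (cone_spin_coord R j v l).
by rewrite addbb.
Qed.

Lemma cone_edge m (p : V * V) : cone j (fun w => m * incident w p)%N false (edge m p).
Proof.
apply: cone_sum => l _; apply: coneZ.
  by rewrite divr_ge0 ?exprn_ge0.
apply: cone_le (cone_exp l (cone_spin_dot p.1 p.2)) => w.
by rewrite -surjective_pairing leq_mul2r ltnW ?orbT.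
Qed.

Definition edges : conf -> R := \prod_(p | P p) edge k.+1 p.

Definition edges_but (p : V * V) : conf -> R := \prod_(q | P q && (q != p)) edge k.+1 q.

Lemma edgesE p : P p -> edges = edge k.+1 p * edges_but p.
Proof. by move=> Pp; rewrite /edges (bigD1 p). Qed.

Lemma cone_edges : cone j (fun w => \sum_(p | P p) k.+1 * incident w p)%N false edges.
Proof. by apply: cone_prod => p _; exact: cone_edge. Qed.

Lemma cone_edges_but q :
  cone j (fun w => \sum_(p | P p && (p != q)) k.+1 * incident w p)%N false (edges_but q).
Proof. by apply: cone_prod => p _; exact: cone_edge. Qed.

Lemma rot_edges a : is_rot i j a edges
  (\sum_(p | P p)
     ((a p.1 - a p.2) *: (beta *: (current i j p.1 p.2 * edge k p))) * edges_but p).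
Proof.
apply: (leibniz_prod (D := is_rot i j a)).
- exact: rot1.
- by move=> *; exact: rotM.
- by move=> p _; exact: rot_edge_weight.
Qed.

Variables (h : R) (h0 : 0 < h) (x : V).

Definition corr v : R := field_mean j h (S v i * (S x i * edges)).

Definition current_mean (p : V * V) : R :=
  field_mean j h (S x i * (current i j p.1 p.2 * edge k p * edges_but p)).

(** The degree bound is that of the full edge product whatever [m] is, so that one comparison
    constant covers the shortened edge factor as well. *)
Let cone_corr_edge m v p : P p -> (m <= k.+1)%N ->
  cone j (fun w => (w == v) + (w == x) + \sum_(q | P q) k.+1 * incident w q)%N false
    (S v i * (S x i * (edge m p * edges_but p))).
Proof.
move=> Pp mk.
have c1 := coneM (cone_spin_coord R j v i) (coneM (cone_spin_coord R j x i)
  (coneM (cone_edge m p) (cone_edges_but p))).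
rewrite (negbTE ij) /= in c1; apply: cone_le c1 => w /=.
rewrite -addnA leq_add2l leq_add2l [leqRHS](bigD1 p)//= leq_add2r leq_mul2r mk orbT//.
Qed.

Lemma corr_ge0 v : 0 <= corr v.
Proof.
have c := coneM (cone_spin_coord R j v i) (coneM (cone_spin_coord R j x i) cone_edges).
exact: field_mean_ge0 h0 c.
Qed.

(** The current is a difference and lies in no cone; each of its two halves does, and is estimated
    separately. *)
Let half_current p u v : conf -> R :=
  S v j * (S u i * (S x i * (edge k p * edges_but p))).

Let cone_half_current p u v : P p -> exists D, cone j D true (half_current p u v).
Proof.
move=> Pp; have := coneM (cone_spin_coord R j v j) (cone_corr_edge u Pp (leqnSn k)).
by rewrite eqxx => c; eexists; exact: c.
Qed.

Let integrable_half_current p u v : P p -> field_integrable j h (half_current p u v).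
Proof. by move=> /(cone_half_current u v)[D c]; exact: cone_integrable c. Qed.

Let currentE p : S x i * (current i j p.1 p.2 * edge k p * edges_but p) =
  half_current p p.1 p.2 + (-1) *: half_current p p.2 p.1.
Proof.
apply/funext => phi; rewrite /half_current /current !fctE /GRing.scale/=; ring.
Qed.

Let current_meanE p : P p -> current_mean p =
  field_mean j h (half_current p p.1 p.2) - field_mean j h (half_current p p.2 p.1).
Proof.
move=> Pp; have i12 u v := integrable_half_current u v Pp.
rewrite /current_mean currentE field_meanD ?field_meanZ ?mulN1r//.
exact: field_integrableZ.
Qed.

(** The polynomial rotated is [S x i * edges]: rotating [S x i] yields [- a x] times [S x j],
    rotating the edge factors yields the currents, and the field yields the left-hand side. *)
Lemma weighted_ward (a : V -> R) :
  h * \sum_v a v * corr v = a x * field_mean j h (S x j * edges) -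
    \sum_(p | P p) (a p.1 - a p.2) * beta * current_mean p.
Proof.
have [_ _] := ward ij h (rotM (rot_coord i j a x i) (rot_edges a)).
rewrite -/(corr _) => /eqP; rewrite addrC addr_eq0 => /eqP ->.
have iM : field_integrable j h (S x j * edges).
  exact: cone_integrable (coneM (cone_spin_coord R j x j) cone_edges).
have iJ p : P p ->
    field_integrable j h (S x i * (current i j p.1 p.2 * edge k p * edges_but p)).
  move=> Pp; rewrite currentE; apply: field_integrableD; last apply: field_integrableZ;
  exact: integrable_half_current.
rewrite (_ : _ + _ = (- a x) *: (S x j * edges) +
    \sum_(p | P p) ((a p.1 - a p.2) * beta) *:
    (S x i * (current i j p.1 p.2 * edge k p * edges_but p))); last first.
  apply/funext => phi; rewrite !fctE !fct_sumE (negbTE ij) eqxx mulr_sumr.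
  congr (_ + _).
    by rewrite mulr0n mulr1n /GRing.scale/=; ring.
  by apply: eq_bigr => p _; rewrite !fctE /GRing.scale/=; ring.
rewrite field_meanD; first last.
- by apply: field_integrable_sum => p Pp; apply: field_integrableZ; exact: iJ.
- exact: field_integrableZ.
rewrite field_meanZ// field_mean_sum => [|p Pp]; last by apply: field_integrableZ; exact: iJ.
rewrite mulNr opprD opprK; congr (_ - _).
by apply: eq_bigr => p Pp; rewrite field_meanZ//; exact: iJ.
Qed.

Section bounds.
Variables (C : R) (d : nat).
Hypothesis C_gt0 : 0 < C.
Hypothesis CP : forall a : 'I_N -> nat, (forall l, (a l <= 2 + k.+1 * d)%N) ->
  moment j h (exp_inc a j) <= C * moment j h a.
Hypothesis dP : forall w, (\sum_(p | P p) incident w p <= d)%N.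

(** The 2 accounts for the factors [S v i] and [S x i], which may sit at the same vertex. *)
Let degree_le v w :
  ((w == v) + (w == x) + \sum_(q | P q) k.+1 * incident w q <= 2 + k.+1 * d)%N.
Proof.
rewrite -big_distrr/= leq_add//; last by rewrite leq_mul2l dP orbT.
by case: (w == v); case: (w == x).
Qed.

Lemma field_mean_edges_le v : field_mean j h (S v j * edges) <= C * field_mean j h edges.
Proof.
apply: (field_mean_coord_le h0 CP _ cone_edges).
by apply: leq_trans (degree_le v v); rewrite leq_addl.
Qed.

(** Removing the factor [S v j] costs the constant [C]. Then the top term, of degree [k], is added
    back to the edge factor, which only increases the mean and completes it to [corr u]. *)
Let edge_corr_le (p : V * V) u v : P p ->
  0 <= field_mean j h (S v j * (S u i * (S x i * (edge k p * edges_but p)))) <= C * corr u.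
Proof.
move=> Pp; have c := cone_corr_edge u Pp (leqnSn k).
apply/andP; split.
  exact: field_mean_ge0 h0 (coneM (cone_spin_coord R j v j) c).
apply: le_trans (field_mean_coord_le h0 CP (degree_le _ _) c) _.
rewrite ler_wpM2l ?(ltW C_gt0)//.
have cl : cone j (fun w => k * incident w p)%N false
    ((beta ^+ k / k`!%:R) *: (@spin_dot R V N p.1 p.2) ^+ k).
  apply: coneZ; first by rewrite divr_ge0 ?exprn_ge0.
  by apply: cone_exp; rewrite [X in incident^~ X]surjective_pairing; exact: cone_spin_dot.
have c2 := coneM (cone_spin_coord R j u i) (coneM (cone_spin_coord R j x i)
  (coneM cl (cone_edges_but p))).
rewrite /corr (edgesE Pp) /edge_weight big_ord_recr/= -/(edge k p).
rewrite mulrDl !mulrDr field_meanD.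
- by rewrite lerDl; exact: field_mean_ge0 h0 c2.
- exact: cone_integrable c.
- exact: cone_integrable c2.
Qed.

Lemma current_mean_le p : P p -> `|current_mean p| <= C * (corr p.1 + corr p.2).
Proof.
move=> Pp.
have /andP[T10 T1] := edge_corr_le p.1 p.2 Pp.
have /andP[T20 T2] := edge_corr_le p.2 p.1 Pp.
rewrite current_meanE// /half_current.
by rewrite ler_norml; apply/andP; split; lra.
Qed.

Lemma corr_sum_le (a : V -> R) (eta : R) : (forall v, 0 <= a v) -> 0 <= eta ->
  (forall p, P p -> `|a p.1 - a p.2| <= eta * a p.1 /\ `|a p.1 - a p.2| <= eta * a p.2) ->
  eta * beta * C * d%:R <= h / 2 ->
  \sum_v a v * corr v <= 2 / h * (a x * (C * field_mean j h edges)).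
Proof.
move=> a0 eta0 aP small.
set T := \sum_v _.
have T0 : 0 <= T by apply: sumr_ge0 => v _; rewrite mulr_ge0 ?corr_ge0.
have M := field_mean_edges_le x.
have aM : a x * field_mean j h (S x j * edges) <= a x * (C * field_mean j h edges).
  by rewrite ler_wpM2l.
have J : - \sum_(p | P p) (a p.1 - a p.2) * beta * current_mean p <= h / 2 * T.
  apply: le_trans (ler_wpM2r T0 small).
  (* The difference of the weights is compared with the weight at [p.1] where it multiplies
     [corr p.1], and with the weight at [p.2] where it multiplies [corr p.2]. *)
  apply: (@le_trans _ _ (\sum_(p | P p)
      eta * beta * C * (a p.1 * corr p.1 + a p.2 * corr p.2))).
    rewrite -sumrN; apply: ler_sum => p Pp; have [a1 a2] := aP _ Pp.
    apply: le_trans (ler_norm _) _; rewrite normrN !normrM (ger0_norm beta0).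
    apply: (@le_trans _ _ (`|a p.1 - a p.2| * beta * (C * (corr p.1 + corr p.2)))).
      by rewrite ler_wpM2l ?mulr_ge0// current_mean_le.
    have c1 := corr_ge0 p.1; have c2 := corr_ge0 p.2.
    have bC : 0 <= beta * C by rewrite mulr_ge0// ltW.
    have -> : `|a p.1 - a p.2| * beta * (C * (corr p.1 + corr p.2)) =
      beta * C * (`|a p.1 - a p.2| * corr p.1 + `|a p.1 - a p.2| * corr p.2) by ring.
    have -> : eta * beta * C * (a p.1 * corr p.1 + a p.2 * corr p.2) =
      beta * C * (eta * a p.1 * corr p.1 + eta * a p.2 * corr p.2) by ring.
    by rewrite ler_wpM2l// lerD// ler_wpM2r.
  rewrite -mulr_sumr -!mulrA !ler_wpM2l ?(ltW C_gt0)//.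
  (* Double counting turns the sum over edges into a sum over vertices, each occurring at most [d]
     times. *)
  have E : \sum_(p | P p) (a p.1 * corr p.1 + a p.2 * corr p.2) =
      \sum_v (\sum_(p | P p) incident v p)%N%:R * (a v * corr v).
    under [RHS]eq_bigr do rewrite natr_sum mulr_suml.
    rewrite exchange_big/=; apply: eq_bigr => p _.
    rewrite /incident; under [RHS]eq_bigr do rewrite natrD mulrDl.
    rewrite big_split/=; congr (_ + _).
      by rewrite (bigD1 p.1)//= eqxx mul1r big1 ?addr0// => v /negbTE ->; rewrite mul0r.
    by rewrite (bigD1 p.2)//= eqxx mul1r big1 ?addr0// => v /negbTE ->; rewrite mul0r.
  rewrite E /T mulr_sumr; apply: ler_sum => v _.
  by rewrite ler_wpM2r ?ler_nat// mulr_ge0// corr_ge0.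
have W := weighted_ward a; rewrite -/T in W.
rewrite mulrAC ler_pdivlMr//; lra.
Qed.

End bounds.

End decay.

(** * Exponential decay in the graph distance *)

Section truncated_distance.
Context (G : sgraph) (x : G).

Definition walk (v : G) (m : nat) : Prop :=
  exists p : seq G, [/\ path (@adj G) x p, last x p = v & size p = m].

(* The minimum of [n] and the graph distance from [x] to [v]. *)
Definition trunc_dist (n : nat) (v : G) : nat :=
  find (fun m => `[< walk v m >]) (iota 0 n).

Lemma trunc_dist_le n v : (trunc_dist n v <= n)%N.
Proof. by rewrite -[leqRHS](size_iota 0 n) find_size. Qed.

Lemma trunc_dist_walk n v m : walk v m -> (m < n)%N -> (trunc_dist n v <= m)%N.
Proof.
move=> wm mn; rewrite leqNgt; apply/negP => lt_m.
have := before_find 0%N lt_m; rewrite nth_iota// add0n.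
by move/asboolP; apply.
Qed.

Lemma trunc_dist_lt n v : (trunc_dist n v < n)%N -> walk v (trunc_dist n v).
Proof.
move=> lt_n; have : has (fun m => `[< walk v m >]) (iota 0 n).
  by rewrite has_find size_iota.
by move/(nth_find 0%N); rewrite nth_iota// add0n => /asboolP.
Qed.

Lemma trunc_dist0 n : trunc_dist n x = 0%N.
Proof.
case: n => [//|n]; apply/eqP; rewrite -leqn0; apply: trunc_dist_walk => //.
by exists [::].
Qed.

(** Truncation preserves the Lipschitz property of the distance. Since edges of a subgraph are edges
    of [G], the weights built from distances in [G] vary slowly along the subgraph too. *)
Lemma trunc_dist_adj n u v : adj u v -> (trunc_dist n v <= (trunc_dist n u).+1)%N.
Proof.
move=> uv; have [lt_n|] := ltnP (trunc_dist n u).+1 n; last first.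
  exact: leq_trans (trunc_dist_le n v).
have [p [xp lp sp]] := trunc_dist_lt (ltnW lt_n).
apply: trunc_dist_walk => //; exists (rcons p v).
by rewrite rcons_path xp lp uv last_rcons size_rcons sp.
Qed.

Lemma trunc_dist_far n v : (forall m, (m < n)%N -> ~ walk v m) -> trunc_dist n v = n.
Proof.
move=> far; apply/eqP; rewrite eqn_leq trunc_dist_le leqNgt.
by apply/negP => lt_n; exact: far (trunc_dist_lt lt_n).
Qed.

Lemma graph_dist_le (R : realType) v m : walk v m -> (graph_dist R x v <= m%:R%:E)%E.
Proof. by move=> wm; apply: ereal_inf_lbound; exists m. Qed.

Lemma graph_dist_far (R : realType) v : (forall m, ~ walk v m) -> graph_dist R x v = +oo%E.
Proof.
move=> far; rewrite /graph_dist (_ : [set _ | n in _] = set0) ?ereal_inf0//.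
by apply/seteqP; split => // z [m /far].
Qed.

End truncated_distance.

(** As [1 <= q], the bound holds relative to the larger power and to the smaller one alike; hence it
    can be used at either end of an edge. *)
Lemma expX_dist_le (R : realType) (q : R) (m n : nat) : 1 <= q ->
  (m <= n.+1)%N -> (n <= m.+1)%N -> `|q ^+ m - q ^+ n| <= (q - 1) * q ^+ m.
Proof.
move=> q1 mn nm; have q0 : 0 <= q by lra.
have E l : `|q ^+ l.+1 - q ^+ l| = (q - 1) * q ^+ l.
  by rewrite exprS -[X in _ - X]mul1r -mulrBl ger0_norm ?mulr_ge0 ?subr_ge0 ?exprn_ge0.
have [->|[->|->]] : m = n \/ n = m.+1 \/ m = n.+1 by lia.
- by rewrite subrr normr0 mulr_ge0 ?subr_ge0 ?exprn_ge0.
- by rewrite distrC E.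
- by rewrite E ler_wpM2l ?subr_ge0// exprS ler_peMl ?exprn_ge0.
Qed.

Section subgraph_degree.
Context (G : sgraph) (D : nat).
Hypothesis degD : forall x : G, ([set y : G | adj x y] #<= `I_D)%card.
Variable g : fin_subgraph G.
Local Notation V := (sub_vertex g).

Lemma sub_degree (w : V) : (#|[set u : V | sub_adj w u]%SET| <= D)%N.
Proof.
have /pcard_leP/unsquash f := degD (val w).
have fD (u : V) : sub_adj w u -> (f (val u) < D)%N.
  by move=> wu; have := 'funS_f (sub_adjP wu).
(* The type ['I_D] would be empty for [D = 0], so the codomain has one extra point; the image misses
   it, which recovers the bound [D]. *)
pose t (u : V) : 'I_D.+1 := inord (f (val u)).
have tE (u : V) : sub_adj w u -> t u = f (val u) :> nat.
  by move=> wu; rewrite inordK// ltnS ltnW// fD.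
rewrite -(card_in_imset (f := t)) => [|u u'].
  have : (t @: [set u : V | sub_adj w u]%SET \subset ~: [set ord_max : 'I_D.+1])%SET.
    apply/fintype.subsetP => z /imsetP[u]; rewrite inE => wu ->.
    by rewrite !inE -val_eqE/= tE// ltn_eqF// fD.
  by move/subset_leq_card => /leq_trans; apply; rewrite cardsC1 card_ord.
rewrite !inE => wu wu' tt; apply/val_inj.
have ff : f (val u) = f (val u') by rewrite -!tE// tt.
by apply: ('inj_f _ _ ff); rewrite inE; exact: sub_adjP.
Qed.

(** Pairs with first component [w] are determined by the second, a neighbour of [w], and
    symmetrically; the two cases give the factor 2. *)
Lemma incident_le (P : pred (V * V)) (w : V) : (forall p, P p -> sub_adj p.1 p.2) ->
  (\sum_(p | P p) incident w p <= 2 * D)%N.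
Proof.
move=> Padj; rewrite /incident big_split/= mul2n -addnn.
have sub_le (f : V * V -> V) (s : V * V -> V) : injective (fun p => (f p, s p)) ->
    (forall p, P p -> sub_adj (f p) (s p)) -> (\sum_(p | P p) (w == f p) <= D)%N.
  move=> inj fs; apply: leq_trans (sub_degree w).
  rewrite -big_mkcondr/= sum1_card -cardsE.
  rewrite -(card_in_imset (f := s)) => [|p p'].
    apply: subset_leq_card; apply/fintype.subsetP => u /imsetP[p].
    by rewrite !inE => /andP[/fs fsp /eqP ->] ->.
  rewrite !inE => /andP[_ /eqP e1] /andP[_ /eqP e2] ss.
  by apply: inj; rewrite -e1 -e2 ss.
apply: leq_add; first by apply: (sub_le fst snd) => // -[? ?] [? ?].
apply: (sub_le snd fst) => [[? ?] [? ?] [-> ->]//|p /Padj].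
by rewrite sub_adj_sym.
Qed.

End subgraph_degree.

Section expectation.
Context (R : realType) (V : finType) (N : nat) (i j : 'I_N) (e : rel V) (k : nat) (beta : R).
Hypotheses (iE : i = 0%N :> nat) (jE : j = N.-1 :> nat).
Hypothesis beta0 : 0 <= beta.

Definition oriented (p : V * V) : bool := e p.1 p.2 && (enum_rank p.1 < enum_rank p.2)%N.

Lemma weightE h (phi : config R V N) :
  weight e k beta h phi = field_weight j h phi * @edges R V N oriented k beta phi.
Proof.
rewrite /weight mulrC; congr (_ * _).
  congr (expR (_ * _)); apply: eq_bigr => v _.
  by rewrite /spin_comp -jE (tnth_nth 0).
rewrite /edges fct_prodE; apply: eq_bigr => p _.
rewrite /edge_weight fct_sumE; apply: eq_bigr => l _.
rewrite !fctE /GRing.scale/= -mulrA (mulrC _^-1).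
by rewrite /spin_dot fct_sumE.
Qed.

(** Reflecting the field component of every spin changes [h] into [- h]; the polynomial is invariant
    because its total degree in that component is even. *)
Lemma field_mean_norm h (D : V -> nat) (F : config R V N -> R) :
  cone j D false F -> field_mean j h F = field_mean j `|h| F.
Proof.
move=> cF; have [h0|h0] := leP 0 h; first by rewrite (ger0_norm h0).
by rewrite (ltr0_norm h0) (field_mean_opp _ cF) mul1r.
Qed.

Lemma expectation_corrE h (x y : V) : i != j ->
  expectation_ON e k beta h (fun phi : config R V N => spin_comp x 0 phi * spin_comp y 0 phi) =
  (field_mean j `|h| (@edges R V N oriented k beta))^-1 * corr i j oriented k beta `|h| x y.
Proof.
move=> ij; have ce := cone_edges j oriented k beta0.
have cc := coneM (cone_spin_coord R j y i) (coneM (cone_spin_coord R j x i) ce).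
rewrite (negbTE ij) in cc.
rewrite /corr -(field_mean_norm h ce) -(field_mean_norm h cc).
rewrite /expectation_ON /partition_function; congr (_^-1 * _).
  by apply: eq_Rintegral => phi _; exact: weightE.
apply: eq_Rintegral => phi _; rewrite weightE !fctE /spin_comp /spin_coord.
rewrite !(tnth_nth 0) iE; ring.
Qed.

End expectation.

(** The constants precede the subgraph, hence are uniform in the volume. The integer [n] stands for
    any lower bound on the distance: the distance itself when it is finite, and every integer when
    it is infinite. *)
Lemma exists_decay (R : realType) (G : sgraph) (G_bounded : bounded_degree G)
    (beta : R) (beta_ge0 : 0 <= beta) (k N : nat) (N_ge2 : (2 <= N)%N) (h : R) : h != 0 ->
  exists eta C : R, [/\ 0 < eta, 0 < C & forall (g : fin_subgraph G) (x y : sub_vertex g),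
    let c := expectation_ON (@sub_adj _ g) k beta h
      (fun phi : config R (sub_vertex g) N => spin_comp x 0 phi * spin_comp y 0 phi) in
    0 <= c /\ forall n, (forall m, (m < n)%N -> ~ walk (val x) (val y) m) ->
      (1 + eta) ^+ n * c <= C].
Proof.
move=> h0; have [D degD] := G_bounded; pose d := (2 * D)%N.
pose i : 'I_N := Ordinal (ltnW N_ge2).
have N1 : (N.-1 < N)%N by rewrite ltn_predL (ltnW N_ge2).
pose j : 'I_N := Ordinal N1.
have ij : i != j by rewrite -val_eqE/= neq_ltn -ltnS prednK ?N_ge2// ltnW.
have g0 : 0 < `|h| by rewrite normr_gt0.
have [C C0 CP] := @moment_inc R N j `|h| (2 + k.+1 * d) g0.
pose B := beta * C * d%:R.
have B0 : 0 <= B by rewrite !mulr_ge0// ltW.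
(* Chosen so that [eta * B <= |h| / 2], the smallness required in [corr_sum_le]; the added 1 covers
   [B = 0]. *)
pose eta := `|h| / 2 / (B + 1).
have eta0 : 0 < eta by rewrite !divr_gt0// ltr_wpDl.
exists eta, (2 / `|h| * C); split => //; first by rewrite !mulr_gt0// invr_gt0.
move=> g x y; rewrite (expectation_corrE (i := i) (j := j))//.
set P := oriented _; set Z := field_mean _ _ _.
have Padj p : P p -> sub_adj p.1 p.2 by move=> /andP[].
have Z0 : 0 <= Z := field_mean_ge0 g0 (cone_edges j P k beta_ge0).
have c0 v : 0 <= corr i j P k beta `|h| x v by exact: corr_ge0.
split=> [|n far]; first by rewrite mulr_ge0// invr_ge0.
pose a (v : sub_vertex g) := (1 + eta) ^+ trunc_dist (val x) n (val v).
have q0 : 0 <= 1 + eta by rewrite addr_ge0// ltW.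
have a0 v : 0 <= a v by rewrite exprn_ge0.
have aP p : P p -> `|a p.1 - a p.2| <= eta * a p.1 /\ `|a p.1 - a p.2| <= eta * a p.2.
  move=> /Padj adj12; have e12 := trunc_dist_adj (val x) n (sub_adjP adj12).
  have e21 : (trunc_dist (val x) n (val p.1) <= (trunc_dist (val x) n (val p.2)).+1)%N.
    by apply: trunc_dist_adj; rewrite adj_sym; exact: sub_adjP.
  have q1 : 1 <= 1 + eta by rewrite lerDl ltW.
  have E m m' : (m <= m'.+1)%N -> (m' <= m.+1)%N ->
      `|(1 + eta) ^+ m - (1 + eta) ^+ m'| <= eta * (1 + eta) ^+ m.
    move=> mm' m'm; have := expX_dist_le q1 mm' m'm.
    by rewrite [1 + eta - 1]addrAC subrr add0r.
  by split; [exact: E|rewrite distrC; exact: E].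
have small : eta * beta * C * d%:R <= `|h| / 2.
  rewrite -!mulrA (mulrA beta) -/B /eta -[leRHS]mulr1 -mulrA ler_wpM2l ?divr_ge0//.
  by rewrite ler_wpM2l// mulrC ler_pdivrMr ?ltr_wpDl// mul1r lerDl.
have := corr_sum_le ij beta_ge0 g0 x C0 CP (fun w => incident_le degD w Padj)
  a0 (ltW eta0) aP small.
rewrite -/Z /a trunc_dist0 expr0 mul1r => sumle.
have yle : (1 + eta) ^+ n * corr i j P k beta `|h| x y <= 2 / `|h| * (C * Z).
  apply: le_trans sumle; rewrite (bigD1 y)//= (trunc_dist_far far) lerDl.
  by apply: sumr_ge0 => v _; rewrite mulr_ge0 ?exprn_ge0.
(* the measure may be signed; if [Z = 0] the expectation is 0, as [0^-1 = 0] *)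
have [Z00|Z_neq0] := eqVneq Z 0.
  by rewrite Z00 invr0 mul0r mulr0 !mulr_ge0// ?invr_ge0// ltW.
have Zp : 0 < Z by rewrite lt_def Z_neq0.
rewrite mulrCA mulrC ler_pdivrMr//; move: yle; rewrite !mulrA//.
Qed.

Unset Implicit Arguments.

Theorem theorem5p1 (R : realType) (G : sgraph)
    (G_infinite : infinite_set [set: G]) (G_bounded : bounded_degree G)
    (beta : R) (beta_ge0 : 0 <= beta)
    (k : nat) (k_gt0 : (0 < k)%N) (N : nat) (N_ge2 : (2 <= N)%N) :
  exists c8 C8 : R -> R,
    (forall h : R, h != 0 ->
       [/\ 0 < c8 h, 0 < C8 h &
         forall (GL : nat -> fin_subgraph G) (L : nat)
                (x y : sub_vertex (GL L)),
           let corr := expectation_ON (@sub_adj _ (GL L)) k beta h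
             (fun phi : config R (sub_vertex (GL L)) N =>
                spin_comp x 0 phi * spin_comp y 0 phi) in
           0 <= corr /\
           (corr%:E <= (C8 h)%:E *
              expeR (- (c8 h)%:E * graph_dist R (val x) (val y)))%E])
    /\ (c8 : R -> R^o) =O_ (0^') (fun h : R => h ^+ 2 : R^o).
Proof.
have /choice[cC cCP] : forall h : R, exists cC : R * R, `|cC.1| <= h ^+ 2 /\
    (h != 0 -> [/\ 0 < cC.1, 0 < cC.2 & forall (g : fin_subgraph G) (x y : sub_vertex g),
      let c := expectation_ON (@sub_adj _ g) k beta h
        (fun phi : config R (sub_vertex g) N => spin_comp x 0 phi * spin_comp y 0 phi) in
      0 <= c /\ (c%:E <= cC.2%:E * expeR (- cC.1%:E * graph_dist R (val x) (val y)))%E]).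
  (* Constants are chosen for all [h] at once; at [h = 0] only the bound by [h ^ 2] is required. *)
  move=> h; have [->|h0] := eqVneq h 0.
    by exists (0, 0); rewrite normr0 expr0n; split => //; rewrite eqxx.
  have [eta [C [eta0 C0 P]]] := exists_decay G_bounded beta_ge0 k N_ge2 h0.
  have h2 : 0 < h ^+ 2 by rewrite exprn_even_gt0.
  have ln0 : 0 < ln (1 + eta) by rewrite ln_gt0// ltrDl.
  have q0 : 0 < 1 + eta by rewrite addr_gt0.
  have qE n : (1 + eta) ^+ n = expR (n%:R * ln (1 + eta)).
    by rewrite expRM_natl lnK.
  exists (Num.min (ln (1 + eta)) (h ^+ 2), C) => /=.
  have c0 : 0 < Num.min (ln (1 + eta)) (h ^+ 2) by rewrite lt_min ln0 h2.
  have ch : Num.min (ln (1 + eta)) (h ^+ 2) <= h ^+ 2 by rewrite ge_min lexx orbT.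
  have cl : Num.min (ln (1 + eta)) (h ^+ 2) <= ln (1 + eta) by rewrite ge_min lexx.
  set c8 := Num.min _ _ in c0 ch cl *.
  split; first by rewrite (ger0_norm (ltW c0)).
  split => // g x y; set c := expectation_ON _ _ _ _ _ => /=.
  have [c_ge0 decay] := P g x y; rewrite -/c in c_ge0 decay; split => //.
  have [[m wm]|far] := pselect (exists m, walk (val x) (val y) m); last first.
    rewrite graph_dist_far => [|m wm]; last by apply: far; exists m.
    rewrite lt0_muley ?lte_fin ?oppr_lt0//= mule0 lee_fin.
    (* The right-hand side is 0. Were the correlation positive, the bound [(1 + eta) ^ n * c <= C],
       available for every [n], would fail once [n] exceeds [C / c / ln (1 + eta)]. *)
    rewrite leNgt; apply/negP => c_gt0.
    have xn0 : 0 <= C / c / ln (1 + eta) by rewrite !divr_ge0// ltW.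
    have := decay (Num.bound (C / c / ln (1 + eta)))
      (fun m _ wm => far (ex_intro _ m wm)).
    apply/negP; rewrite -ltNge -ltr_pdivrMr// qE.
    apply: lt_le_trans (expR_ge1Dx _).
    by apply: ltr_wpDl => //; rewrite -ltr_pdivrMr//; exact: archi_boundP.
  (* The least length [l] of a walk is admissible in [decay], while a walk of that length bounds the
     distance by [l]; this gives [exp (- c8 * l) <= exp (- c8 * d(x, y))]. *)
  have ex : exists m, `[< walk (val x) (val y) m >] by exists m; exact/asboolP.
  have [l /asboolP wl lmin] := ex_minnP ex.
  have far m' : (m' < l)%N -> ~ walk (val x) (val y) m'.
    by move=> m'l w'; have := lmin m' (asboolT w'); rewrite leqNgt m'l.
  have := decay l far; rewrite qE -ler_pdivlMl ?expR_gt0// -expRN mulrC => cle.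
  apply: (@le_trans _ _ (C%:E * (expR (- (c8 * l%:R)))%:E)%E).
    rewrite -EFinM lee_fin (le_trans cle)// ler_wpM2l ?(ltW C0)// ler_expR lerN2.
    by rewrite mulrC ler_wpM2l.
  apply: lee_wpmul2l; first by rewrite lee_fin ltW.
  rewrite -[leLHS]/(expeR (- (c8 * l%:R))%:E) lee_expeR !EFinN EFinM mulNe leeN2.
  by apply: lee_wpmul2l; [rewrite lee_fin ltW|exact: graph_dist_le].
exists (fun h => (cC h).1), (fun h => (cC h).2); split.
  move=> h h0; have [_ /(_ h0)[c0 C0 P]] := cCP h; split => // GL L x y.
  exact: P.
apply/eqO_exP; exists 1 => //; near=> h.
rewrite mul1r [leRHS]ger0_norm ?sqr_ge0//.
by have [] := cCP h.
Unshelve. all: end_near. Qed.
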